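(* Let $K$ be a field of characteristic zero, $\mathcal A=K[x,y,z]$, and let $\lambda=z$ and $P=\widetilde P+\frac{1}{r+2}z^{r+2}$ with $\widetilde P\in K[x,y]$, $r\in\mathbb N$, such that $P$ is weight homogeneous for some weights $\varpi_1,\varpi_2,\varpi_3$ of $x,y,z$ respectively and has an isolated singularity. Suppose that $\varpi_1+\varpi_2-\varpi_3\geq 0$. Let $\pi$ be the generalized Jacobian Poisson structure on $\mathcal A$ given by $\lambda$ and the Casimir $P$. Then the third Poisson cohomology group is given by $$PH^3(\mathcal A,\pi)=K[P]\otimes\mathcal A_{sing}(P'),\qquad\text{where } P'=\widetilde P+\frac{1}{r+3}z^{r+3}.$$
   Context: Weights are positive integers without common divisor; a nonzero polynomial is weight homogeneous of degree $d$ if it is a $K$-linear combination of monomials $x^ay^bz^c$ with $a\varpi_1+b\varpi_2+c\varpi_3=d$. For $U\in\mathcal A$, $\mathcal A_{sing}(U)=\mathcal A/\langle \partial U/\partial x,\partial U/\partial y,\partial U/\partial z\rangle$; $U$ has an isolated singularity if $\mathcal A_{sing}(U)$ is finite dimensional over $K$. $\mathbb N$ includes $0$. $\nabla$, $\nabla\times$, $\times$, $\cdot$ are the formal gradient, curl, vector product and scalar product. The Poisson structure is $\{f,g\}=\lambda\,\frac{df\wedge dg\wedge dP}{dx\wedge dy\wedge dz}$. Let $\mathcal X^k(\mathcal A)$ be the module of skew-symmetric $k$-derivations of $\mathcal A$. With $\mathcal X^2(\mathcal A)\cong\mathcal A^3$ via $F_1\frac{\partial}{\partial y}\wedge\frac{\partial}{\partial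 z}+F_2\frac{\partial}{\partial z}\wedge\frac{\partial}{\partial x}+F_3\frac{\partial}{\partial x}\wedge\frac{\partial}{\partial y}\mapsto(F_1,F_2,F_3)$ and $\mathcal X^3(\mathcal A)\cong\mathcal A$ via $U\frac{\partial}{\partial x}\wedge\frac{\partial}{\partial y}\wedge\frac{\partial}{\partial z}\mapsto U$, the last Poisson coboundary operator is $\delta^2:\mathcal A^3\to\mathcal A$, $$\delta^2(\vec G)=-\lambda\,\nabla P\cdot(\nabla\times\vec G)-\vec G\cdot(\nabla\lambda\times\nabla P),$$ and $PH^3(\mathcal A,\pi)=\mathcal A/\delta^2(\mathcal A^3)$.
   Formalization: The equality is a graded isomorphism of K-vector spaces; it is K[P]-linear when ϖ1+ϖ2−ϖ3>0, but when ϖ1+ϖ2=ϖ3 only on classes without constant term, since there P·[1]=0 in PH^3 and K[P]-linearity fails. *)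

(* Defs.v *)
From HB Require Import structures.
From mathcomp Require Import all_boot all_order all_algebra.
From mathcomp Require Import boolp.
From mathcomp Require Import mpoly.
From mathcomp Require Import ring.

Set Implicit Arguments.
Unset Strict Implicit.
Unset Printing Implicit Defensive.

Import GRing.Theory.
Local Open Scope ring_scope.
Local Open Scope quotient_scope.

(* Membership in the image is made boolean with [asbool], so that the         *)
(* library quotients apply.                                                   *)

Definition limage (K : pzRingType) (U V : lmodType K) (f : {linear U -> V}) :
  {pred V} := fun v => `[< exists u, v = f u >].

Section Limage.
Variables (K : pzRingType) (U V : lmodType K) (f : {linear U -> V}).

Lemma limageP v : reflect (exists u, v = f u) (v \in limage f).
Proof. exact: asboolP. Qed.

Lemma limage_submod_closed : submod_closed (limage f).
Proof.
split; first by apply/limageP; exists 0; rewrite linear0.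
move=> a _ _ /limageP[u ->] /limageP[v ->].
by apply/limageP; exists (a *: u + v); rewrite linearP.
Qed.

HB.instance Definition _ :=
  GRing.isSubmodClosed.Build K V (limage f) limage_submod_closed.

Definition coker : Type := Quotient.quot (limage f).

HB.instance Definition _ := GRing.Zmodule.on coker.

Definition coker_pi (x : V) : coker := \pi_(Quotient.quot (limage f)) x.
Definition coker_repr (c : coker) : V :=
  repr (c : Quotient.quot (limage f)).

Lemma coker_reprK : cancel coker_repr coker_pi.
Proof. exact: reprK. Qed.

Lemma coker_piP x y : coker_pi x = coker_pi y <-> exists u, x - y = f u.
Proof.
by split=> [/eqP|h]; [|apply/eqP]; rewrite -Quotient.idealrBE;
  [move/limageP | apply/limageP].
Qed.

Lemma coker_pi_is_zmod_morphism : zmod_morphism coker_pi.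
Proof. exact: (raddfB (\pi_(Quotient.quot (limage f)))). Qed.

HB.instance Definition _ :=
  GRing.isZmodMorphism.Build V coker coker_pi coker_pi_is_zmod_morphism.

Definition coker_scale (a : K) (c : coker) : coker :=
  coker_pi (a *: coker_repr c).

Lemma coker_pi_scale (a : K) (x : V) :
  coker_pi (a *: x) = coker_scale a (coker_pi x).
Proof.
have /coker_piP[u xE] := esym (coker_reprK (coker_pi x)).
by apply/coker_piP; exists (a *: u); rewrite -scalerBr xE linearZ.
Qed.

Fact coker_scaleA a b c :
  coker_scale a (coker_scale b c) = coker_scale (a * b) c.
Proof. by rewrite -[c]coker_reprK -!coker_pi_scale scalerA. Qed.

Fact coker_scale1 : left_id 1 coker_scale.
Proof. by move=> c; rewrite -[c]coker_reprK -coker_pi_scale scale1r. Qed.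

Fact coker_scaleDr : right_distributive coker_scale +%R.
Proof.
move=> a c d; rewrite -[c]coker_reprK -[d]coker_reprK.
by rewrite -raddfD -!coker_pi_scale -raddfD scalerDr.
Qed.

Fact coker_scaleDl c : {morph coker_scale^~ c : a b / a + b}.
Proof.
by move=> a b; rewrite -[c]coker_reprK -!coker_pi_scale scalerDl raddfD.
Qed.

HB.instance Definition _ := GRing.Zmodule_isLmodule.Build K coker
  coker_scaleA coker_scale1 coker_scaleDr coker_scaleDl.

HB.instance Definition _ :=
  GRing.isScalable.Build K V coker *:%R coker_pi coker_pi_scale.

End Limage.

Definition finite_dimensional (K : pzRingType) (V : lmodType K) : Prop :=
  exists (n : nat) (b : 'I_n -> V),
    forall v, exists a : 'I_n -> K, v = \sum_i a i *: b i.

Definition is_tensor_product (K : nzRingType) (U V T : lmodType K)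
    (t : {bilinear U -> V -> T}) : Prop :=
  forall (W : lmodType K) (b : {bilinear U -> V -> W}),
    (exists f : {linear T -> W}, forall u v, f (t u v) = b u v) /\
    (forall f g : {linear T -> W},
       (forall u v, f (t u v) = b u v) -> (forall u v, g (t u v) = b u v) ->
       f =1 g).

Definition ix : 'I_3 := @Ordinal 3 0 isT.
Definition iy : 'I_3 := @Ordinal 3 1 isT.
Definition iz : 'I_3 := @Ordinal 3 2 isT.

Section VectorCalculus.
Variable K : fieldType.

Definition vec : Type := {ffun 'I_3 -> {mpoly K[3]}}.
HB.instance Definition _ := GRing.Lmodule.copy vec {ffun 'I_3 -> {mpoly K[3]}}.

Definition mkvec (a b c : {mpoly K[3]}) : vec :=
  [ffun i => nth 0 [:: a; b; c] (val i)].

Definition dot (u v : vec) : {mpoly K[3]} := \sum_i u i * v i.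

Definition cross (u v : vec) : vec :=
  mkvec (u iy * v iz - u iz * v iy)
        (u iz * v ix - u ix * v iz)
        (u ix * v iy - u iy * v ix).

Definition grad (f : {mpoly K[3]}) : vec := [ffun i => mderiv i f].

Definition curl (u : vec) : vec :=
  mkvec (mderiv iy (u iz) - mderiv iz (u iy))
        (mderiv iz (u ix) - mderiv ix (u iz))
        (mderiv ix (u iy) - mderiv iy (u ix)).

Definition dot_grad (U : {mpoly K[3]}) (G : vec) : {mpoly K[3]} :=
  dot G (grad U).

Lemma dot_grad_is_linear U : linear (dot_grad U).
Proof.
move=> a u v; rewrite /dot_grad /dot scaler_sumr -big_split /=.
by apply: eq_bigr => i _; rewrite !ffunE mulrDl scalerAl.
Qed.

HB.instance Definition _ U :=
  GRing.isLinear.Build K vec {mpoly K[3]} *:%R (dot_grad U)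
    (dot_grad_is_linear U).

(* The image of [dot_grad U] is the ideal generated by the three partial      *)
(* derivatives of U.                                                          *)
Definition Asing (U : {mpoly K[3]}) := coker (dot_grad U).

Definition isolated_singularity (U : {mpoly K[3]}) : Prop :=
  finite_dimensional (Asing U).

Definition delta2 (lam P : {mpoly K[3]}) (G : vec) : {mpoly K[3]} :=
  - (lam * dot (grad P) (curl G)) - dot G (cross (grad lam) (grad P)).

Lemma delta2_is_linear lam P : linear (delta2 lam P).
Proof.
move=> a u v; rewrite /delta2 /dot !big_ord_recl !big_ord0 !ffunE /=.
rewrite !raddfD /= !linearZ /= -!mul_mpolyC.
by ring.
Qed.

HB.instance Definition _ lam P :=
  GRing.isLinear.Build K vec {mpoly K[3]} *:%R (delta2 lam P)
    (delta2_is_linear lam P).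

(* Third Poisson cohomology of the structure {f,g} = lam df^dg^dP/dx^dy^dz,   *)
(* 3-derivations and 2-derivations being identified with A and A^3.           *)
Definition PH3 (lam P : {mpoly K[3]}) := coker (delta2 lam P).

(* [genalg P] is the set of the values q(P), so [Kadjoin P] is the subalgebra *)
(* K[P] of K[x,y,z] (not a polynomial ring in a new variable).                *)
Definition genalg (P : {mpoly K[3]}) : {pred {mpoly K[3]}} :=
  fun f => `[< exists q : {poly K}, f = horner_alg P q >].

Lemma genalgP P f : reflect (exists q : {poly K}, f = horner_alg P q)
                            (f \in genalg P).
Proof. exact: asboolP. Qed.

Lemma genalg_subalg_closed P : subalg_closed (genalg P).
Proof.
split; first by apply/genalgP; exists 1; rewrite rmorph1.
  move=> a _ _ /genalgP[p ->] /genalgP[q ->].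
  apply/genalgP; exists (a *: p + q).
  by rewrite rmorphD -mul_polyC rmorphM /= horner_algC mulr_algl.
move=> _ _ /genalgP[p ->] /genalgP[q ->].
by apply/genalgP; exists (p * q); rewrite rmorphM.
Qed.

HB.instance Definition _ P :=
  GRing.isSubalgClosed.Build K {mpoly K[3]} (genalg P) (genalg_subalg_closed P).

Record Kadjoin (P : {mpoly K[3]}) : predArgType :=
  KAdjoin { Kadjoin_val :> {mpoly K[3]}; _ : Kadjoin_val \in genalg P }.

HB.instance Definition _ P := [isSub for @Kadjoin_val P].
HB.instance Definition _ P := [Choice of Kadjoin P by <:].
HB.instance Definition _ P := [SubChoice_isSubAlgebra of Kadjoin P by <:].

(* Weights w1, w2, w3 of x, y, z.  The zero polynomial is homogeneous of      *)
(* every degree for [whomog_deg] and is excluded in [whomog].                 *)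
Definition wdeg (w1 w2 w3 : nat) (m : 'X_{1..3}) : nat :=
  (m ix * w1 + m iy * w2 + m iz * w3)%N.

Definition whomog_deg (w1 w2 w3 d : nat) (f : {mpoly K[3]}) : Prop :=
  forall m, m \in msupp f -> wdeg w1 w2 w3 m = d.

Definition whomog (w1 w2 w3 : nat) (f : {mpoly K[3]}) : Prop :=
  f != 0 /\ exists d, whomog_deg w1 w2 w3 d f.

Definition coker_whomog_deg (w1 w2 w3 d : nat)
    (f : {linear vec -> {mpoly K[3]}}) (c : coker f) : Prop :=
  exists2 a, whomog_deg w1 w2 w3 d a & coker_pi f a = c.

End VectorCalculus.

(* Main.v *)
(* Write T for the part of P in K[x,y], d for the weighted degree of P,
   theta = z d/dz and J(h) = T_x h_y - T_y h_x.  The image Im of delta^2 is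
   the set of all

     (theta - 1)(T_x F_1 + T_y F_2) - z^(r+2) (d_x F_1 + d_y F_2) + z J(h),

   and it lies in the ideal I = (T_x, T_y, z^(r+2)) generated by the partial
   derivatives of P'.

   Spanning.  Let L be the inverse of w_1 x d_x + w_2 y d_y + w_1 + w_2, and
   W the operator multiplying a monomial by its weight.  Modulo Im, Euler's
   formula and the Poincare lemma give
     T_x F_1 + T_y F_2 = d T L(div F)   and   z^(r+2) h = d T L (theta - 1) h,
   so that every element of I is congruent to some T u, while
   P v = T L (W + c) v with c = w_1 + w_2 - w_3.  The operator W + c is
   invertible, except on the constants when c = 0; hence, by induction on the
   weight, the products of powers of P by normal forms modulo I span the
   cokernel.  When c = 0 the class of P vanishes, and the multiples P^i of the
   constant normal form have to be replaced by T^i.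

   Freeness.  By the isolated singularity, T_x and T_y are coprime.  If P g is
   in Im, Euler's formula turns this membership into a syzygy of
   (T_x, T_y, z^(r+2)), which is a Koszul syzygy; taking the divergence of
   the latter gives (W + c) g in Im. *)

Require Import Defs.
From HB Require Import structures.
From mathcomp Require Import all_boot all_order all_algebra.
From mathcomp Require Import boolp mpoly ring zify.

Set Implicit Arguments.
Unset Strict Implicit.
Unset Printing Implicit Defensive.

Import Order.TTheory GRing.Theory.
Local Open Scope ring_scope.

(** * Diagonal operators on multivariate polynomials *)

Section DiagonalOperators.
Variables (n : nat) (R : comNzRingType).
Implicit Types (phi psi : 'X_{1..n} -> R) (p q : {mpoly R[n]}).

Definition mdiag phi p : {mpoly R[n]} :=
  \sum_(m <- msupp p) (phi m * p@_m) *: 'X_[m].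

Lemma mcoeff_diag phi p m : (mdiag phi p)@_m = phi m * p@_m.
Proof.
rewrite raddf_sum /=; under eq_bigr do rewrite mcoeffZ mcoeffX.
have [mp|mp] := boolP (m \in msupp p).
  rewrite (bigD1_seq m) //= eqxx mulr1 big1 ?addr0 // => k /negPf kNm.
  by rewrite kNm mulr0.
rewrite (memN_msupp_eq0 mp) mulr0 big_seq big1 // => k kp.
by case: eqP kp mp => [->->|] //; rewrite mulr0.
Qed.

Lemma mdiag_is_linear phi : linear (mdiag phi).
Proof.
move=> a p q; apply/mpolyP => m.
by rewrite !(mcoeff_diag, mcoeffD, mcoeffZ); ring.
Qed.

HB.instance Definition _ phi :=
  GRing.isLinear.Build R {mpoly R[n]} {mpoly R[n]} *:%R (mdiag phi)
    (mdiag_is_linear phi).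

Lemma eq_mdiag phi psi p :
  {in msupp p, phi =1 psi} -> mdiag phi p = mdiag psi p.
Proof.
move=> e; apply/mpolyP => m; rewrite !mcoeff_diag.
by have [/e->//|/memN_msupp_eq0->] := boolP (m \in msupp p); rewrite !mulr0.
Qed.

Lemma mdiag_comp phi psi p :
  mdiag phi (mdiag psi p) = mdiag (fun m => phi m * psi m) p.
Proof. by apply/mpolyP => m; rewrite !mcoeff_diag mulrA. Qed.

Lemma mdiag_id phi p : {in msupp p, forall m, phi m = 1} -> mdiag phi p = p.
Proof.
move=> e; apply/mpolyP => m; rewrite mcoeff_diag.
have [/e->|/memN_msupp_eq0->] := boolP (m \in msupp p); last by rewrite mulr0.
by rewrite mul1r.
Qed.

Lemma mdiag_eq0 phi p : {in msupp p, forall m, phi m = 0} -> mdiag phi p = 0.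
Proof.
move=> e; apply/mpolyP => m; rewrite mcoeff_diag mcoeff0.
have [/e->|/memN_msupp_eq0->] := boolP (m \in msupp p); last by rewrite mulr0.
by rewrite mul0r.
Qed.

(** Meant for [p] homogeneous in the grading on which [phi] depends: multiplication by [p] then only
    translates the argument of [phi]. *)
Lemma mdiagM phi psi p q :
  {in msupp p, forall k m, phi (k + m)%MM = psi m} ->
  mdiag phi (p * q) = p * mdiag psi q.
Proof.
move=> e; apply/mpolyP => m; rewrite mcoeff_diag !mcoeffM mulr_sumr.
apply: eq_bigr => -[k l] /= /eqP mE; rewrite mcoeff_diag [phi m](congr1 phi mE).
have [/e->|/memN_msupp_eq0->] := boolP (bmnm k \in msupp p); last by ring.
by ring.
Qed.

Lemma mdiag_mderiv phi psi i p :
  (forall m, psi (m + U_(i))%MM = phi m) ->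
  mdiag phi p^`M(i) = (mdiag psi p)^`M(i).
Proof.
move=> e; apply/mpolyP => m.
by rewrite !(mcoeff_diag, mcoeff_deriv) e mulrnAr.
Qed.

Lemma XiM_mderiv i p : 'X_i * p^`M(i) = mdiag (fun m => (m i)%:R) p.
Proof.
apply/mpolyP => m; rewrite mcoeff_diag mulrC.
case: (posnP (m i)) => [mi0|mi_gt0].
  rewrite mi0 mul0r mcoeffM big1 // => -[k l] /= /eqP mE.
  rewrite mcoeffX; case: eqP => [lE|_]; last by rewrite mulr0.
  move: (congr1 (fun m : 'X_{1..n} => m i) mE).
  by rewrite mi0 mnmDE -lE mnm1E eqxx addn1.
have mE : m = (U_(i) + (m - U_(i)))%MM.
  rewrite addmC submK //; apply/mnm_lepP => j.
  by rewrite mnm1E; case: eqP => [<-|].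
rewrite [in LHS]mE mcoeffMX mcoeff_deriv mulr_natl addmC -mE.
by rewrite mnmBE mnm1E eqxx subn1 prednK.
Qed.

Lemma mpoly_divXn i k p :
  exists q, p = mdiag (fun m => (m i < k)%:R) p + 'X_i ^+ k * q.
Proof.
elim/mpolyind: p => [|c m p mp c0 [q IH]].
  by exists 0; rewrite raddf0 mulr0 addr0.
rewrite raddfD /= {1}IH.
have [mk|km] := ltnP (m i) k.
  exists q; rewrite [X in _ = X + _ + _]mdiag_id ?addrA // => m'.
  by rewrite msuppMCX // inE => /eqP->; rewrite mk.
exists (q + c *: 'X_[m - U_(i) *+ k]).
rewrite [X in _ = X + _ + _]mdiag_eq0; last first.
  by move=> m'; rewrite msuppMCX // inE => /eqP->; rewrite ltnNge km.
rewrite add0r mulrDr addrC -addrA -scalerAr mpolyXn -mpolyXD.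
congr (_ + (_ + _ *: 'X_[_])); rewrite addmC submK //; apply/mnm_lepP => j.
by rewrite mulmnE mnm1E; case: eqP => [<-|]; rewrite ?mul1n.
Qed.

Lemma mdiag_XnM i k p : mdiag (fun m => (m i < k)%:R) ('X_i ^+ k * p) = 0.
Proof.
rewrite (@mdiagM _ (fun=> 0)); last first.
  move=> m; rewrite mpolyXn msuppX inE => /eqP-> m'.
  by rewrite mnmDE mulmnE mnm1E eqxx mul1n ltnNge leq_addr.
by rewrite [X in _ * X]mdiag_eq0 ?mulr0.
Qed.

Lemma mdiag_ltnK i k p (R0 := mdiag (fun m => (m i < k)%:R) p) :
  mdiag (fun m => (m i < k)%:R) R0 = R0.
Proof.
rewrite mdiag_comp; apply: eq_mdiag => m _.
by rewrite -natrM mulnb andbb.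
Qed.

End DiagonalOperators.

(** * Coprimality of powers of two distinct variables *)

Section CoprimePowers.
Variables (n : nat) (R : idomainType) (i j : 'I_n).
Hypothesis ij : i != j.
Implicit Types a g q : {mpoly R[n]}.

Lemma mpolyXin_neq0 k N : 'X_k ^+ N != 0 :> {mpoly R[n]}.
Proof.
apply/eqP => /mpolyP/(_ (U_(k) *+ N)%MM)/eqP.
by rewrite mpolyXn mcoeffX eqxx mcoeff0 oner_eq0.
Qed.

(** Cancelling [g] gives [q1 * 'X_j ^+ N2 = q2 * 'X_i ^+ N1]. The remainder of [q1] modulo
    ['X_i ^+ N1], times ['X_j ^+ N2], is then both reduced and a multiple of ['X_i ^+ N1], hence
    zero. *)
Lemma dvd_of_dvd_MXn a g q1 q2 N1 N2 : g != 0 ->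
  a * 'X_i ^+ N1 = g * q1 -> a * 'X_j ^+ N2 = g * q2 -> exists q, a = g * q.
Proof.
move=> g0 e1 e2; have [q q1E] := mpoly_divXn i N1 q1.
set s := mdiag _ q1 in q1E.
have q12 : q1 * 'X_j ^+ N2 = q2 * 'X_i ^+ N1.
  by apply: (mulfI g0); rewrite !mulrA -e1 -e2 mulrAC.
have s0 : s = 0.
  apply: (mulfI (mpolyXin_neq0 j N2)); rewrite mulr0 -[s]mdiag_ltnK.
  rewrite -(@mdiagM _ _ (fun m => (m i < N1)%:R)); last first.
    move=> m; rewrite mpolyXn msuppX inE => /eqP-> m'.
    by rewrite mnmDE mulmnE mnm1E eq_sym (negPf ij).
  have -> : 'X_j ^+ N2 * s = 'X_i ^+ N1 * (q2 - q * 'X_j ^+ N2).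
    by rewrite mulrBr ![_ * q2]mulrC -q12 q1E; ring.
  exact: mdiag_XnM.
exists q; apply: (mulIf (mpolyXin_neq0 i N1)).
by rewrite e1 q1E s0 add0r; ring.
Qed.

End CoprimePowers.

(** * Tensor products and normal forms *)

Lemma big_nat_pad (V : nmodType) (n N : nat) (F : nat -> V) :
  (n <= N)%N -> (forall i, (n <= i)%N -> F i = 0) ->
  \sum_(i < N) F i = \sum_(i < n) F i.
Proof.
move=> nN F0; rewrite (big_ord_widen N F nN) [RHS]big_mkcond /=.
by apply: eq_bigr => i _; case: ltnP => // /F0.
Qed.

Section TensorProductCriterion.
Variables (K : fieldType) (U V T : lmodType K) (t : {bilinear U -> V -> T}).
Variable p : nat -> U.
Hypothesis p_span :
  forall u, exists n (a : nat -> K), u = \sum_(i < n) a i *: p i.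
Hypothesis t_span :
  forall w, exists n (s : nat -> V), w = \sum_(i < n) t (p i) (s i).
Hypothesis t_free :
  forall n (s : nat -> V), \sum_(i < n) t (p i) (s i) = 0 ->
  forall i, (i < n)%N -> s i = 0.

Let t_coord w : exists ns : nat * (nat -> V),
  w = \sum_(i < ns.1) t (p i) (ns.2 i) /\ forall i, (ns.1 <= i)%N -> ns.2 i = 0.
Proof.
have [n [s ->]] := t_span w.
exists (n, fun i => if (i < n)%N then s i else 0); split => /= [|i]; last first.
  by case: ltnP.
by apply: eq_bigr => i _; rewrite ltn_ord.
Qed.

(** The induced map applies [b] to coordinates along the [p i]; [t_free] makes it independent of the
    chosen coordinates. *)
Lemma tensor_product_criterion : is_tensor_product t.
Proof.
move=> W b; split; last first.
  move=> f g fE gE w; have [n [s ->]] := t_span w.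
  by rewrite !linear_sum; apply: eq_bigr => i _; rewrite fE gE.
have [C CP] := choice t_coord.
pose s w := (C w).2; pose N w := (C w).1.
have tE w M : (N w <= M)%N -> \sum_(i < M) t (p i) (s w i) = w.
  move=> NM; rewrite [RHS](CP w).1.
  rewrite (big_nat_pad (F := fun i => t (p i) (s w i)) NM) //.
  by move=> i /(CP w).2 si0; rewrite /s si0 linear0r.
pose f w := \sum_(i < N w) b (p i) (s w i).
have fE w M : (N w <= M)%N -> \sum_(i < M) b (p i) (s w i) = f w.
  move=> NM; rewrite (big_nat_pad (F := fun i => b (p i) (s w i)) NM) //.
  by move=> i /(CP w).2 si0; rewrite /s si0 linear0r.
have f_val n (s' : nat -> V) w : w = \sum_(i < n) t (p i) (s' i) ->
    f w = \sum_(i < n) b (p i) (s' i).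
  pose s'' i := if (i < n)%N then s' i else 0.
  pose M := maxn n (N w).
  have sumE (Z : lmodType K) (c : {bilinear U -> V -> Z}) :
      \sum_(i < n) c (p i) (s' i) = \sum_(i < M) c (p i) (s'' i).
    rewrite (@big_nat_pad _ n M (fun i => c (p i) (s'' i))) ?leq_maxl //.
      by apply: eq_bigr => i _; rewrite /s'' ltn_ord.
    by move=> i; rewrite /s'' ltnNge => ->; rewrite linear0r.
  rewrite !sumE -(fE _ M) ?leq_maxr // -{1}(tE w M) ?leq_maxr // => /eqP.
  rewrite -subr_eq0 -sumrB; under eq_bigr do rewrite -linearBr.
  move=> /eqP /(t_free (s := fun i => s w i - s'' i)) ss.
  apply: eq_bigr => i _; congr (b _ _); apply/eqP; rewrite -subr_eq0.
  by rewrite ss.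
have f_linear : linear f.
  move=> a u v; pose M := maxn (N u) (N v).
  rewrite -(fE u M) ?leq_maxl // -(fE v M) ?leq_maxr // scaler_sumr.
  rewrite -big_split /=.
  rewrite (f_val M (fun i => a *: s u i + s v i)).
    by apply: eq_bigr => i _; rewrite linearPr.
  transitivity (a *: \sum_(i < M) t (p i) (s u i)
                + \sum_(i < M) t (p i) (s v i)).
    by rewrite !tE ?leq_maxl ?leq_maxr.
  by rewrite scaler_sumr -big_split; apply: eq_bigr => i _; rewrite linearPr.
pose fL : {linear T -> W} :=
  HB.pack f (GRing.isLinear.Build _ _ _ _ f f_linear).
exists fL => u v /=; have [n [a ->]] := p_span u.
have sumE (Z : lmodType K) (c : {bilinear U -> V -> Z}) :
    c (\sum_(i < n) a i *: p i) v = \sum_(i < n) c (p i) (a i *: v).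
  rewrite linear_sumlz; apply: eq_bigr => i _.
  by rewrite linearZl_LR linearZr_LR.
by rewrite (f_val n (fun i => a i *: v)) sumE.
Qed.

End TensorProductCriterion.

(** * Normal forms modulo a subspace of polynomials *)

Section NormalForm.
Variables (n : nat) (K : fieldType) (S : submodClosed {mpoly K[n]}).
Implicit Types p q : {mpoly K[n]}.

Let subS : {in S &, forall p q, p - q \in S}.
Proof. by move=> p q pS qS; rewrite -scaleN1r rpredD ?rpredZ. Qed.

(** These are the standard monomials of Groebner basis theory, for a linear subspace [S] instead of
    an ideal. *)
Definition standard (m : 'X_{1..n}) : Prop :=
  forall p, p \in S -> p != 0 -> mlead p <> m.

Definition reduced p : Prop := {in msupp p, forall m, standard m}.

Lemma reducedP a p q : reduced p -> reduced q -> reduced (a *: p + q).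
Proof.
move=> rp rq m /msuppD_le; rewrite mem_cat => /orP[/msuppZ_le|].
  exact: rp.
exact: rq.
Qed.

Lemma reduced_eq0 p : reduced p -> p \in S -> p = 0.
Proof.
by move=> rp pS; apply/eqP/negPn/negP => p0; apply: (rp _ (mlead_supp p0) p).
Qed.

(** Division algorithm: a leading term that is not standard is cancelled by an element of [S], a
    standard one is moved to the result. *)
Lemma reduced_exists p : exists q, reduced q /\ p - q \in S.
Proof.
elim/mleadrect: p => p IH; have [->|p0] := eqVneq p 0.
  by exists 0; rewrite subr0 rpred0; split=> // m; rewrite msupp0.
have [[b [bS b0 bE]]|st] :=
    pselect (exists b, [/\ b \in S, b != 0 & mlead b = mlead p]).
  pose p' := p - (mleadc p / mleadc b) *: b.
  (* Zero is set apart because [mlead 0] is [0%MM], which is not below [mlead p] for constant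
     [p]. *)
  have : p' = 0 \/ (mlead p' < mlead p)%O.
    have [->|p'0] := eqVneq p' 0; [by left | right].
    rewrite lt_neqAle; apply/andP; split; last first.
      apply: le_trans (mleadB_le _ _) _.
      rewrite leUx lexx /= -[in leRHS]bE.
      exact: mleadZ_le.
    apply: contraNneq p'0 => p'E; rewrite -mleadc_eq0 p'E mcoeffB mcoeffZ -bE.
    by rewrite divfK ?mleadc_eq0 ?subrr.
  have p'P q : (p' - q \in S) -> (p - q \in S).
    move=> h; rewrite -[p](subrK ((mleadc p / mleadc b) *: b)) addrAC.
    by rewrite rpredD ?rpredZ.
  case=> [p'0|/IH[q [rq /p'P qS]]]; last by exists q.
  exists 0; split=> [m|]; first by rewrite msupp0.
  by apply: p'P; rewrite p'0 subrr rpred0.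
pose p' := p - mleadc p *: 'X_[mlead p].
have stp : standard (mlead p) by move=> b bS b0 bE; apply: st; exists b.
have [q [rq qS]] : exists q, reduced q /\ p' - q \in S.
  have [->|p'0] := eqVneq p' 0.
    by exists 0; rewrite subr0 rpred0; split=> // m; rewrite msupp0.
  apply: IH; rewrite lt_neqAle; apply/andP; split; last first.
    apply: le_trans (mleadB_le _ _) _.
    rewrite leUx lexx /=.
    by apply: le_trans (mleadZ_le _ _) _; rewrite mleadXm.
  apply: contraNneq p'0 => p'E; rewrite -mleadc_eq0 p'E mcoeffB mcoeffZ mcoeffX.
  by rewrite eqxx mulr1 subrr.
exists (mleadc p *: 'X_[mlead p] + q); split; last by rewrite opprD addrA.
by apply: reducedP => // m; rewrite msuppX inE => /eqP->.
Qed.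

Definition nform p : {mpoly K[n]} := sval (cid (reduced_exists p)).

Lemma nform_reduced p : reduced (nform p).
Proof. by rewrite /nform; case: cid => q []. Qed.

Lemma subr_nform p : p - nform p \in S.
Proof. by rewrite /nform; case: cid => q []. Qed.

Lemma nform_unique p q : reduced q -> p - q \in S -> nform p = q.
Proof.
move=> rq pq; apply/eqP; rewrite -subr_eq0; apply/eqP/reduced_eq0.
  by rewrite addrC -scaleN1r; apply: reducedP => //; apply: nform_reduced.
have -> : nform p - q = (p - q) - (p - nform p) by ring.
by apply: subS; rewrite ?subr_nform.
Qed.

Lemma nform_is_linear : linear nform.
Proof.
move=> a p q; apply: nform_unique.
  exact/reducedP/nform_reduced/nform_reduced.
by rewrite opprD addrACA -scalerBr rpredD ?rpredZ ?subr_nform.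
Qed.

HB.instance Definition _ :=
  GRing.isLinear.Build K _ _ *:%R nform nform_is_linear.

Lemma nform_eq p q : p - q \in S -> nform p = nform q.
Proof.
move=> pq; apply: nform_unique; first exact: nform_reduced.
by rewrite -(subrKA q) rpredD ?subr_nform.
Qed.

Lemma nform_id p : reduced p -> nform p = p.
Proof. by move=> rp; apply: nform_unique; rewrite ?subrr ?rpred0. Qed.

(** A diagonal operator creates no monomial, hence preserves reduced polynomials, and normal forms
    are unique. *)
Lemma mdiag_nform (phi : 'X_{1..n} -> K) p :
  (forall q, q \in S -> mdiag phi q \in S) ->
  nform (mdiag phi p) = mdiag phi (nform p).
Proof.
move=> phiS; apply: nform_unique; last by rewrite -raddfB phiS ?subr_nform.
move=> m; rewrite mcoeff_msupp mcoeff_diag mulf_eq0 negb_or => /andP[_].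
by rewrite -mcoeff_msupp; apply: nform_reduced.
Qed.

End NormalForm.

(** * Decomposition of a graded cokernel *)

(* [P] is a zero divisor modulo [Im] when [c = 0], and [B ^+ i] stands for the
   multiple of [1] by [P ^+ i]. *)
Section Decomposition.
Variables (K : fieldType) (k : nat) (Im I : submodClosed {mpoly K[k]}).
Variables (P B : {mpoly K[k]}) (wd : 'X_{1..k} -> nat).
Local Notation A := {mpoly K[k]}.
Implicit Types (a g p q : A) (u : nat -> A) (e : nat -> K) (s : K).

Hypothesis Im_sub : forall a, a \in Im -> a \in I.
Hypothesis I_proper : 1 \notin I -> forall a, a \in I -> a@_0%MM = 0.
Hypothesis I_full : 1 \in I -> forall a, a \in I.
Hypothesis I_filtered : forall N a,
  a \in I -> mdiag (fun m => (wd m < N)%:R) a \in I.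
Hypothesis PM_I : forall a, P * a \in I.
Hypothesis BM_I : forall a, B * a \in I.
Hypothesis B0 : B@_0%MM = 0.
Hypothesis PM_Im : forall a, a \in Im -> P * a \in Im.
Variable gam : nat -> K.
Hypothesis gam_neq0 : forall i, gam i != 0.
Hypothesis PBX_Im : forall i, P * B ^+ i.+1 - gam i *: B ^+ i.+2 \in Im.
Hypothesis Im_regular : 1 \notin I -> forall g s,
  g@_0%MM = 0 -> P * g + s *: B \in Im -> s = 0 /\ g \in Im.
Hypothesis I_mod_Im : forall N a,
  a \in I -> {in msupp a, forall m, (wd m < N.+1)%N} ->
  exists g s, [/\ a - (P * g + s *: B) \in Im,
    {in msupp g, forall m, (wd m < N)%N},
    1 \in I -> s = 0 & 1 \notin I -> g@_0%MM = 0].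

Let Im_oppr a : a \in Im -> - a \in Im.
Proof. by move=> aI; rewrite -scaleN1r rpredZ. Qed.

(** The coefficient of [P ^+ i] is the normal form [u i + (e i)%:MP], whose constant part is
    multiplied by [B ^+ i] instead. *)
Definition term (u : nat -> A) (e : nat -> K) i : A :=
  P ^+ i * u i + e i *: B ^+ i.

Definition admissible (u : nat -> A) (e : nat -> K) : Prop :=
  forall i, [/\ reduced I (u i), (u i)@_0%MM = 0 & 1 \in I -> e i = 0].

Lemma reduced_C s : (1 \in I -> s = 0) -> reduced I s%:MP.
Proof.
move=> s0 m; have [/s0->|I1] := boolP (1 \in I); first by rewrite msupp0.
rewrite msuppC; case: eqP => //= _; rewrite inE => /eqP-> p pI p0 pE.
by move: p0; rewrite -mleadc_eq0 pE I_proper ?eqxx.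
Qed.

Lemma reduced_split a (b := a - (a@_0%MM)%:MP) : reduced I a ->
  [/\ reduced I b, b@_0%MM = 0 & 1 \in I -> a@_0%MM = 0].
Proof.
move=> ra; have a0 : 1 \in I -> a@_0%MM = 0.
  by move=> /I_full /(_ a)/(reduced_eq0 ra)->; rewrite mcoeff0.
split=> //; last by rewrite mcoeffB mcoeffC eqxx mulr1 subrr.
by rewrite /b addrC -scaleN1r; apply: reducedP => //; apply: reduced_C.
Qed.

(** The vanishing of [e 0%N] keeps out [P * 1], for which no congruence with [B] is available, and
    makes [gam i.-1] harmless at [i = 0]. *)
Lemma shift_term (u : nat -> A) (e : nat -> K) n :
  admissible u e -> e 0%N = 0 ->
  P * (\sum_(i < n) term u e i)
  - \sum_(i < n) (P ^+ i.+1 * u i + (e i * gam i.-1) *: B ^+ i.+1) \in Im.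
Proof.
move=> ad e0; rewrite mulr_sumr -sumrB; apply: rpred_sum => -[[|i] iN] _ /=.
  by rewrite /term e0 mul0r !scale0r !addr0 expr0 mul1r expr1 subrr rpred0.
have -> : P * term u e i.+1
    - (P ^+ i.+2 * u i.+1 + (e i.+1 * gam i) *: B ^+ i.+2) =
    e i.+1 *: (P * B ^+ i.+1 - gam i *: B ^+ i.+2).
  by rewrite /term -!mul_mpolyC mpolyCM !exprS; ring.
by rewrite rpredZ.
Qed.

(** Induction on a weight bound: [a] minus its normal form lies in [I], hence is [P * g + s *: B]
    modulo [Im] with [g] of smaller weight, and the decomposition of [g] is shifted. *)
Lemma term_span a : exists (n : nat) u e, [/\ admissible u e &
  a - \sum_(i < n) term u e i \in Im].
Proof.
suff H N : forall a, {in msupp a, forall m, (wd m < N)%N} ->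
    exists n u e, [/\ admissible u e, a@_0%MM = 0 -> e 0%N = 0 &
      a - \sum_(i < n.+1) term u e i \in Im].
  have [|n [u [e [ad _ aE]]]] := H (\max_(m <- msupp a) (wd m).+1)%N a.
    by move=> m ma; rewrite (big_rem m) //= leq_max leqnn.
  by exists n.+1, u, e.
elim: N => [|N IH] {}a aN.
  exists 0%N, (fun=> 0), (fun=> 0); split=> //.
    by split; rewrite ?mcoeff0 // => m; rewrite msupp0.
  rewrite (_ : a = 0) ?sub0r; last first.
    apply/eqP; rewrite -msupp_eq0; case: (msupp a) aN => // m s /(_ m).
    by rewrite inE eqxx => /(_ isT).
  rewrite Im_oppr // big_ord1 /term mulr0 scale0r addr0; exact: rpred0.
have [u0 [e0 [naE ru0 u00 e00]]] : exists b s,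
    [/\ nform I a = b + s%:MP, reduced I b, b@_0%MM = 0 & 1 \in I -> s = 0].
  have [rb b0 s0] := reduced_split (@nform_reduced _ _ I a).
  exists (nform I a - ((nform I a)@_0%MM)%:MP), (nform I a)@_0%MM.
  by rewrite subrK.
have naN : {in msupp (a - nform I a), forall m, (wd m < N.+1)%N}.
  have aE : a = mdiag (fun m => (wd m < N.+1)%:R) a.
    by rewrite mdiag_id // => m /aN ->.
  move=> m; rewrite aE mdiag_nform; last exact: I_filtered.
  rewrite -raddfB mcoeff_msupp mcoeff_diag.
  by case: ltnP => //; rewrite mul0r eqxx.
have [g [eB [gE gN eB0 g0]]] := I_mod_Im (@subr_nform _ _ I a) naN.
have [n [u [e [ad ge0 gsum]]]] := IH g gN.
have e0E : e 0%N = 0.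
  by have [|/g0/ge0//] := boolP (1 \in I); case: (ad 0%N).
pose u' i := if i is j.+1 then u j else u0.
(* As [e 0%N = 0], the coefficient of [B] itself is [eB], the multiple split off with [g]. *)
pose e' i := if i is j.+1 then e j * gam j.-1 + (j == 0%N)%:R * eB else e0.
exists n.+1, u', e'; split.
- case=> [|i]; split=> //=; try by case: (ad i).
  move=> I1; rewrite eB0 //; case: (ad i) => _ _ -> //.
  by rewrite mul0r mulr0 addr0.
- move=> a0; rewrite /e'; have [/e00//|I1] := boolP (1 \in I).
  have := I_proper I1 (@subr_nform _ _ I a).
  rewrite naE mcoeffB a0 mcoeffD u00 mcoeffC eqxx mulr1 !add0r.
  by move/eqP; rewrite oppr_eq0 => /eqP.
have sumE : \sum_(i < n.+2) term u' e' i = nform I a + eB *: B +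
    \sum_(i < n.+1) (P ^+ i.+1 * u i + (e i * gam i.-1) *: B ^+ i.+1).
  rewrite big_ord_recl naE /term /= mul1r expr0 -mul_mpolyC mulr1 -!addrA.
  congr (_ + (_ + _)); rewrite [in RHS]big_ord_recl [in LHS]big_ord_recl /=.
  rewrite mul1r addrA; congr (_ + _).
    by rewrite scalerDl !expr1; ring.
  by apply: eq_bigr => i _; rewrite /= mul0r addr0.
have := rpredD gE (rpredD (PM_Im gsum) (shift_term n.+1 ad e0E)).
have eqE (x y z t : A) :
    a - x - (P * g + y) + (P * (g - z) + (P * z - t)) = a - (x + y + t) by ring.
by rewrite eqE sumE.
Qed.

(** Modulo [I] only the term of index 0 survives, and a normal form in [I] is zero. The rest is
    [P * g + e 1 *: B] modulo [Im], with [g] a shorter sum of the same kind, to which [Im_regular]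
    leads. *)
Lemma term_free n u e : admissible u e -> \sum_(i < n) term u e i \in Im ->
  forall i, (i < n)%N -> u i = 0 /\ e i = 0.
Proof.
move=> ad; have [I1|I1] := boolP (1 \in I).
  move=> _ i _; case: (ad i) => ru _ -> //; split=> //.
  exact/(reduced_eq0 ru)/I_full.
elim: n u e ad => [//|n IH] u e ad; rewrite big_ord_recl /= => sumIm.
have tailI : \sum_(i < n) term u e (bump 0 i) \in I.
  apply: rpred_sum => i _; rewrite /term !exprS -mulrA scalerAr.
  by rewrite rpredD ?PM_I ?BM_I.
have e0 : u 0%N + (e 0%N)%:MP = 0.
  have [ru u0 _] := ad 0%N; apply: (@reduced_eq0 _ _ I).
    rewrite -[u 0%N]scale1r; apply: reducedP => //; apply: reduced_C.
    by rewrite (negPf I1).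
  have := rpredD (Im_sub sumIm) (rpredZ (-1) tailI).
  by rewrite scaleN1r addrK /term mul1r expr0 -mul_mpolyC mulr1.
have [u00 e00] : u 0%N = 0 /\ e 0%N = 0.
  have e00 : e 0%N = 0.
    have := congr1 (mcoeff 0%MM) e0; rewrite mcoeffD mcoeffC eqxx mulr1 mcoeff0.
    by case: (ad 0%N) => _ ->; rewrite add0r.
  by move: e0; rewrite e00 addr0.
move: sumIm; rewrite {1}/term u00 e00 mulr0 scale0r !add0r => sumIm.
case: n => [|n] in IH tailI sumIm *; first by case.
(* Division by [gam] undoes the rescaling of [shift_term]; [e 1%N] is left out and becomes the [s]
   of [Im_regular]. *)
pose u' i := u i.+1; pose e' i := if i is j.+1 then e i.+1 / gam j else 0.
have ad' : admissible u' e'.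
  move=> j; have [ruj uj0 _] := ad j.+1; split=> //.
  by rewrite (negPf I1).
set g := \sum_(i < n.+1) term u' e' i.
have g0 : g@_0%MM = 0.
  rewrite raddf_sum big1 //= => i _; rewrite /term mcoeffD mcoeffZ !rmorphM /=.
  have [_ -> _] := ad' i; rewrite mulr0 add0r.
  by case: (i : nat) => [|j]; rewrite ?mul0r // rmorphXn /= B0 expr0n mulr0.
have [e1 gIm] : e 1%N = 0 /\ g \in Im.
  apply: Im_regular => //.
  rewrite -[P * g](subrK (\sum_(i < n.+1)
    (P ^+ i.+1 * u' i + (e' i * gam i.-1) *: B ^+ i.+1))) -addrA rpredD //.
    exact: shift_term.
  move: sumIm; rewrite (_ : \sum_(i < n.+1) _ = \sum_(i < n.+1)
    (P ^+ i.+1 * u' i + (e' i * gam i.-1) *: B ^+ i.+1) + e 1%N *: B) //.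
  rewrite [in LHS]big_ord_recl [in RHS]big_ord_recl.
  rewrite [RHS]addrAC /term /bump /= !mul0r scale0r addr0; congr (_ + _).
  by apply: eq_bigr => i _; rewrite /e' /= add1n divfK.
case=> [//|i]; rewrite ltnS => iN; have [ui ei] := IH u' e' ad' gIm i iN.
split=> //; case: i ei {ui iN} => [//|i] /=.
by move/eqP; rewrite mulf_eq0 invr_eq0 (negPf (gam_neq0 _)) orbF => /eqP.
Qed.

End Decomposition.

(** * The Poisson coboundary *)

Lemma eq_of_subr (V : zmodType) (a b a' b' : V) :
  a - b = a' - b' -> a' = b' -> a = b.
Proof. by move=> e ab; apply/eqP; rewrite -subr_eq0 e ab subrr. Qed.

Lemma dotE (K : fieldType) (u v : vec K) :
  dot u v = u ix * v ix + u iy * v iy + u iz * v iz.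
Proof.
rewrite /dot !big_ord_recl big_ord0 addr0 addrA.
have <- : ord0 = ix by exact: val_inj.
have <- : lift ord0 (ord0 : 'I_2) = iy by exact: val_inj.
by have <- : lift ord0 (lift ord0 (ord0 : 'I_1)) = iz by exact: val_inj.
Qed.

Section Poisson.
Variables (K : fieldType) (r : nat) (T : {mpoly K[3]}) (w1 w2 w3 : nat).
Hypothesis charK : [pchar K] =i pred0.
Hypotheses (w1_gt0 : (0 < w1)%N) (w2_gt0 : (0 < w2)%N) (w3_gt0 : (0 < w3)%N).
Hypothesis T_zfree : {in msupp T, forall m : 'X_{1..3}, m iz = 0%N}.
Hypothesis T_whomog : whomog_deg w1 w2 w3 (r.+2 * w3) T.

Local Notation A := {mpoly K[3]}.
Local Notation x := ('X_ix : A).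
Local Notation y := ('X_iy : A).
Local Notation z := ('X_iz : A).
Local Notation dx := (mderiv ix).
Local Notation dy := (mderiv iy).
Local Notation dz := (mderiv iz).
Local Notation Tx := (dx T).
Local Notation Ty := (dy T).
Local Notation d := (r.+2 * w3)%N.
Local Notation wd := (wdeg w1 w2 w3).
Local Notation wxy m := (m ix * w1 + m iy * w2)%N.
Implicit Types (F G V : A) (a b g h p q u v : A) (m : 'X_{1..3}).

(** * Weights, Euler's formula and the derivatives of [T] *)

Let natr_neq0 n : (0 < n)%N -> (n%:R : K) != 0.
Proof. by rewrite (pcharf0P K).1 // lt0n. Qed.

Lemma wdegD m m' : wd (m + m')%MM = (wd m + wd m')%N.
Proof. by rewrite /wdeg !mnmDE; lia. Qed.

Lemma wdegU : (wd U_(ix)%MM = w1) * (wd U_(iy)%MM = w2) * (wd U_(iz)%MM = w3).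
Proof. by rewrite /wdeg !mnm1E /=; split; [split|]; lia. Qed.

Lemma wdeg_eq0 m : (wd m == 0%N) = (m == 0%MM).
Proof.
apply/eqP/eqP => [|->]; last by rewrite /wdeg !mnm0E.
rewrite /wdeg => wm0; apply/mnmP => -[[|[|[|//]]] i3]; rewrite mnm0E.
- by rewrite (_ : Ordinal i3 = ix); [nia|exact: val_inj].
- by rewrite (_ : Ordinal i3 = iy); [nia|exact: val_inj].
- by rewrite (_ : Ordinal i3 = iz); [nia|exact: val_inj].
Qed.

Lemma mderivXU (i j : 'I_3) : mderiv i ('X_j : A) = (i == j)%:R.
Proof.
rewrite mderivX mnm1E eq_sym; case: eqP => [->|_]; last by rewrite scale0r.
rewrite scale1r (_ : (_ - _)%MM = 0%MM) ?mpolyX0 //.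
by apply/mnmP => k; rewrite mnmBE subnn mnm0E.
Qed.

Lemma msupp_Tx m : m \in msupp Tx -> m iz = 0%N /\ (wd m + w1 = d)%N.
Proof.
rewrite mcoeff_msupp mcoeff_deriv => n0.
have mT : (m + U_(ix))%MM \in msupp T.
  by rewrite mcoeff_msupp; apply: contra_neq n0 => ->; rewrite mul0rn.
split; last by rewrite -(T_whomog mT) wdegD wdegU.
by have := T_zfree mT; rewrite mnmDE; lia.
Qed.

Lemma msupp_Ty m : m \in msupp Ty -> m iz = 0%N /\ (wd m + w2 = d)%N.
Proof.
rewrite mcoeff_msupp mcoeff_deriv => n0.
have mT : (m + U_(iy))%MM \in msupp T.
  by rewrite mcoeff_msupp; apply: contra_neq n0 => ->; rewrite mul0rn.
split; last by rewrite -(T_whomog mT) wdegD wdegU.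
by have := T_zfree mT; rewrite mnmDE; lia.
Qed.

Lemma mderiv_zfree p :
  {in msupp p, forall m : 'X_{1..3}, m iz = 0%N} -> dz p = 0.
Proof.
move=> pz; apply/mpolyP => m; rewrite mcoeff_deriv mcoeff0.
have [/pz|/memN_msupp_eq0->] := boolP ((m + U_(iz))%MM \in msupp p).
  by rewrite mnmDE mnm1E addn1.
by rewrite mul0rn.
Qed.

Lemma dzTx : dz Tx = 0. Proof. by apply: mderiv_zfree => m /msupp_Tx[]. Qed.
Lemma dzTy : dz Ty = 0. Proof. by apply: mderiv_zfree => m /msupp_Ty[]. Qed.
Lemma dzT : dz T = 0. Proof. exact: mderiv_zfree. Qed.

Lemma mdiag_wxy n u :
  mdiag (fun m => (wxy m + n)%:R) u = x * dx u *+ w1 + y * dy u *+ w2 + u *+ n.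
Proof.
rewrite !XiM_mderiv; apply/mpolyP => m.
by rewrite !(mcoeffD, mcoeffMn, mcoeff_diag) !natrD !natrM; ring.
Qed.

Lemma mdiag_wd n u : mdiag (fun m => (wd m + n)%:R) u =
  x * dx u *+ w1 + y * dy u *+ w2 + z * dz u *+ w3 + u *+ n.
Proof.
rewrite !XiM_mderiv; apply/mpolyP => m.
by rewrite !(mcoeffD, mcoeffMn, mcoeff_diag) !natrD !natrM; ring.
Qed.

Lemma euler_T : x * Tx *+ w1 + y * Ty *+ w2 = T *+ d.
Proof.
rewrite -[LHS]addr0 -[0 in LHS](mulr0n T) -mdiag_wxy; apply/mpolyP => m.
rewrite mcoeff_diag mcoeffMn.
have [mT|/memN_msupp_eq0->] := boolP (m \in msupp T); last first.
  by rewrite mulr0 mul0rn.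
by rewrite -(T_whomog mT) /wdeg (T_zfree mT) mulr_natl mul0n.
Qed.

(** * The image of the coboundary operator and its grading *)

Definition rel F1 F2 h : A :=
  z * (Tx * dz F1 + Ty * dz F2) - (Tx * F1 + Ty * F2)
  - z ^+ r.+2 * (dx F1 + dy F2) + z * (Tx * dy h - Ty * dx h).

Let P : A := T + (r.+2%:R : K)^-1 *: z ^+ r.+2.

Lemma mderiv_zXn n : (dx (z ^+ n) = 0) * (dy (z ^+ n) = 0) *
  (dz (z ^+ n.+1) = z ^+ n *+ n.+1).
Proof.
have dX i k : i != iz -> mderiv i (z ^+ k) = 0.
  move=> iz0; elim: k => [|k IH]; first by rewrite expr0 mderivC.
  by rewrite exprS mderivM mderivXU IH (negPf iz0) mul0r mulr0 addr0.
split; first by rewrite !dX.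
elim: n => [|n IH]; first by rewrite expr1 mderivXU expr0.
by rewrite exprS mderivM IH mderivXU /= exprS; ring.
Qed.

Lemma mderiv_T_zXn n :
  let U := T + (n.+1%:R : K)^-1 *: z ^+ n.+1 in
  (dx U = Tx) * (dy U = Ty) * (dz U = z ^+ n).
Proof.
rewrite /= !mderivD !mderivZ !mderiv_zXn dzT !scaler0 !addr0 add0r.
by rewrite -scaler_nat scalerA mulVf ?natr_neq0 // scale1r.
Qed.

Local Notation Im := (limage (delta2 z P)).

(** Setting [F1 = G iy] and [F2 = - G ix] turns the third component of the curl of [G] into the
    divergence of [(F1, F2)]. *)
Lemma ImP a : reflect (exists F1 F2 h, a = rel F1 F2 h) (a \in Im).
Proof.
have [[Px Py] Pz] := mderiv_T_zXn r.+1.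
have delta2E (G : vec K) : delta2 z P G = rel (G iy) (- G ix) (- G iz).
  rewrite /delta2 !dotE !ffunE /=.
  rewrite Px Py Pz /rel !mderivXU /= !raddfN /= [in RHS]exprS; ring.
apply: (iffP (limageP _ _)) => [[G ->]|[F1 [F2 [h ->]]]].
  by exists (G iy), (- G ix), (- G iz); exact: delta2E.
exists (mkvec (- F2) F1 (- h)).
by apply/esym; apply: etrans (delta2E _) _; rewrite !ffunE /= !opprK.
Qed.

(* Multiplication by a homogeneous polynomial and differentiation shift the
   weight by a fixed amount, possibly negative: [shift f a b] is the shift of
   [f] by [a - b]. *)
Definition shift (f : nat -> K) s t m : K := f (wd m + s - t)%N.

Lemma shift0 f : shift f 0 0 = f \o wd.
Proof. by apply: funext => m; rewrite /shift addn0 subn0. Qed.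

Lemma shift_Tx f s t u :
  mdiag (shift f s t) (Tx * u) = Tx * mdiag (shift f (s + d) (t + w1)) u.
Proof.
apply: mdiagM => m /msupp_Tx[_ <-] m'.
by rewrite /shift wdegD; congr f; lia.
Qed.

Lemma shift_Ty f s t u :
  mdiag (shift f s t) (Ty * u) = Ty * mdiag (shift f (s + d) (t + w2)) u.
Proof.
apply: mdiagM => m /msupp_Ty[_ <-] m'.
by rewrite /shift wdegD; congr f; lia.
Qed.

Lemma shift_T f s t u :
  mdiag (shift f s t) (T * u) = T * mdiag (shift f (s + d) t) u.
Proof.
apply: mdiagM => m /T_whomog mE m'.
by rewrite /shift wdegD mE; congr f; lia.
Qed.

Lemma shift_z f s t n u :
  mdiag (shift f s t) (z ^+ n * u) = z ^+ n * mdiag (shift f (s + n * w3) t) u.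
Proof.
apply: mdiagM => m; rewrite mpolyXn msuppX inE => /eqP-> m'.
rewrite /shift; have -> : wd (U_(iz) *+ n + m')%MM = (n * w3 + wd m')%N.
  by rewrite /wdeg !mnmDE !mulmnE !mnm1E /=; lia.
by congr f; lia.
Qed.

Lemma shift_mderiv f s t i u :
  mdiag (shift f s t) (mderiv i u) =
  mderiv i (mdiag (shift f s (t + wd U_(i)%MM)) u).
Proof. by apply: mdiag_mderiv => m; rewrite /shift wdegD; congr f; lia. Qed.

Lemma eq_shift f s t s' t' : (s + t' = s' + t)%N -> shift f s t = shift f s' t'.
Proof. by move=> e; apply: funext => m; congr f; lia. Qed.

(** Each term of [rel] shifts weights by a constant depending only on the slot [F1], [F2] or [h];
    hence [Im] is graded. *)
Lemma rel_graded f F1 F2 h :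
  mdiag (f \o wd) (rel F1 F2 h) =
  rel (mdiag (shift f d w1) F1) (mdiag (shift f d w2) F2)
      (mdiag (shift f (w3 + d) (w1 + w2)) h).
Proof.
have shift_z1 s t u :
    mdiag (shift f s t) (z * u) = z * mdiag (shift f (s + w3) t) u.
  by rewrite -{1}[z]expr1 shift_z expr1 mul1n.
have E s t s' t' u : (s + t' = s' + t)%N ->
    mdiag (shift f s t) u = mdiag (shift f s' t') u.
  by move=> /eq_shift->.
have relE G1 G2 g : rel G1 G2 g =
    z * (Tx * dz G1) + z * (Ty * dz G2) - Tx * G1 - Ty * G2
    - z ^+ r.+2 * dx G1 - z ^+ r.+2 * dy G2
    + z * (Tx * dy g) - z * (Ty * dx g) by rewrite /rel; ring.
have e1 : mdiag (shift f 0 0) (z * (Tx * dz F1)) =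
    z * (Tx * dz (mdiag (shift f d w1) F1)).
  by rewrite shift_z1 shift_Tx shift_mderiv wdegU (E _ _ d w1) //; lia.
have e2 : mdiag (shift f 0 0) (z * (Ty * dz F2)) =
    z * (Ty * dz (mdiag (shift f d w2) F2)).
  by rewrite shift_z1 shift_Ty shift_mderiv wdegU (E _ _ d w2) //; lia.
have e7 : mdiag (shift f 0 0) (z * (Tx * dy h)) =
    z * (Tx * dy (mdiag (shift f (w3 + d) (w1 + w2)) h)).
  by rewrite shift_z1 shift_Tx shift_mderiv wdegU.
have e8 : mdiag (shift f 0 0) (z * (Ty * dx h)) =
    z * (Ty * dx (mdiag (shift f (w3 + d) (w1 + w2)) h)).
  rewrite shift_z1 shift_Ty shift_mderiv wdegU.
  by rewrite (E _ _ (w3 + d)%N (w1 + w2)%N) //; lia.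
rewrite !relE -shift0 !(raddfB, raddfD) /= e1 e2 e7 e8.
by rewrite shift_Tx shift_Ty !shift_z !shift_mderiv !wdegU.
Qed.

(** * Congruences modulo the image *)

Local Notation J h := (Tx * dy h - Ty * dx h).

(** Split [h = h0 + z * q] with [h0] free of [z]. The third slot of [rel] yields [z * J q], and the
    divergence-free field [(- dy h0, dx h0)] yields [J h0]. *)
Lemma J_in_Im h : J h \in Im.
Proof.
have [q ->] := mpoly_divXn iz 1 h.
set h0 := mdiag _ h; rewrite expr1.
have dzh0 : dz h0 = 0.
  apply: mderiv_zfree => m; rewrite mcoeff_msupp mcoeff_diag mulf_eq0 negb_or.
  by case: (m iz) => //= n; rewrite eqxx.
apply/ImP; exists (- dy h0), (dx h0), q.
rewrite /rel !(mderivD, mderivM, mderivN, mderivXU) /=.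
rewrite ![dz (mderiv _ _)]mderiv_comm dzh0 !mderiv0 [dy (dx _)]mderiv_comm.
ring.
Qed.

Lemma Im_graded f a : a \in Im -> mdiag (f \o wd) a \in Im.
Proof.
move=> /ImP[F1 [F2 [h ->]]]; rewrite rel_graded; apply/ImP.
by do 3!eexists.
Qed.

(** Poincare lemma in [x] and [y]: contraction with the Euler field and division by the weight give
    a potential [h], and the combination is [J h]. *)
Lemma divfree_in_Im X1 X2 : dx X1 + dy X2 = 0 -> Tx * X1 + Ty * X2 \in Im.
Proof.
move=> /eqP; rewrite addrC addr_eq0 => /eqP divX.
pose h0 := y * X1 *+ w2 - x * X2 *+ w1.
(* At monomials in [z] alone the factor is [0^-1 = 0], which is harmless because [h] is only
   differentiated in [x] and [y]. *)
pose h := mdiag (fun m => (wxy m)%:R^-1) h0.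
suff [<- X2E] : dy h = X1 /\ - dx h = X2.
  by rewrite -X2E mulrN; apply: J_in_Im.
have inv_id n u : (0 < n)%N ->
    mdiag (fun m => (wxy m + n)%:R^-1) (mdiag (fun m => (wxy m + n)%:R) u) = u.
  move=> n_gt0; rewrite mdiag_comp; apply: mdiag_id => m _.
  by rewrite mulVf // natr_neq0 // addn_gt0 n_gt0 orbT.
split.
- rewrite -(@mdiag_mderiv _ _ (fun m => (wxy m + w2)%:R^-1)); last first.
    by move=> m; congr (_%:R^-1); rewrite !mnmDE !mnm1E /=; lia.
  rewrite -[RHS](inv_id w2) // mdiag_wxy; congr mdiag.
  by rewrite !(mderivB, mderivMn, mderivM, mderivXU) /= divX; ring.
- rewrite -(@mdiag_mderiv _ _ (fun m => (wxy m + w1)%:R^-1)); last first.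
    by move=> m; congr (_%:R^-1); rewrite !mnmDE !mnm1E /=; lia.
  rewrite -[RHS](inv_id w1) // mdiag_wxy -raddfN; congr mdiag.
  by rewrite !(mderivB, mderivMn, mderivM, mderivXU) /= divX; ring.
Qed.

Local Notation D u := (mdiag (fun m => (wxy m + (w1 + w2))%:R) u).
Local Notation L u := (mdiag (fun m => (wxy m + (w1 + w2))%:R^-1) u).

Lemma DL u : D (L u) = u.
Proof.
rewrite mdiag_comp; apply: mdiag_id => m _.
by rewrite mulfV // natr_neq0 // addn_gt0 orbC addn_gt0 w1_gt0.
Qed.

(** The divergence of [u] times the Euler field [(w1 x, w2 y)] is [D u]; subtracting this field from
    [(F1, F2)], with [u = L (div F)], leaves a field without divergence. *)
Lemma gradT_mod_Im F1 F2 :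
  Tx * F1 + Ty * F2 - T * L (dx F1 + dy F2) *+ d \in Im.
Proof.
set u := L _.
have -> : Tx * F1 + Ty * F2 - T * u *+ d =
    Tx * (F1 - x * u *+ w1) + Ty * (F2 - y * u *+ w2).
  by rewrite -mulrnAl -euler_T; ring.
apply: divfree_in_Im; have := DL (dx F1 + dy F2); rewrite -/u mdiag_wxy => uE.
rewrite !(mderivB, mderivMn, mderivM, mderivXU) /=.
have -> : dx F1 = x * dx u *+ w1 + y * dy u *+ w2 + u *+ (w1 + w2) - dy F2.
  by rewrite uE addrK.
by ring.
Qed.

(** Up to sign, this is [rel] at [u] times the Euler field, with [h = 0]. *)
Lemma zXnD_mod_Im u : z ^+ r.+2 * D u - T * (z * dz u - u) *+ d \in Im.
Proof.
rewrite -rpredN; apply/ImP; exists (x * u *+ w1), (y * u *+ w2), 0.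
rewrite -mulrnAl -euler_T mdiag_wxy /rel.
by rewrite !(mderivMn, mderivM, mderivXU, mderiv0) /=; ring.
Qed.

(** [P] is a Casimir, so [delta^2] commutes with multiplication by [P]: the terms in the derivatives
    of [P] cancel. *)
Lemma PM_in_Im a : a \in Im -> P * a \in Im.
Proof.
have [[Px Py] Pz] := mderiv_T_zXn r.+1.
move=> /ImP[F1 [F2 [h ->]]]; apply/ImP; exists (P * F1), (P * F2), (P * h).
by rewrite /rel !mderivM Px Py Pz !exprS; ring.
Qed.

(** * Jacobian ideals: that of [P] for [n = r.+1], that of [P'] for [n = r.+2] *)

Local Notation I_ n := (limage (dot_grad (T + (n.+1%:R : K)^-1 *: z ^+ n.+1))).

Lemma idealP n a : reflect
  (exists F1 F2 h, a = Tx * F1 + Ty * F2 + z ^+ n * h) (a \in I_ n).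
Proof.
have [[Ux Uy] Uz] := mderiv_T_zXn n.
have dot_gradE (G : vec K) :
    dot_grad (T + (n.+1%:R : K)^-1 *: z ^+ n.+1) G =
    Tx * G ix + Ty * G iy + z ^+ n * G iz.
  by rewrite /dot_grad dotE !ffunE Ux Uy Uz; ring.
apply: (iffP (limageP _ _)) => [[G ->]|[F1 [F2 [h ->]]]].
  by exists (G ix), (G iy), (G iz); exact: dot_gradE.
exists (mkvec F1 F2 h).
by apply/esym; apply: etrans (dot_gradE _) _; rewrite !ffunE.
Qed.

Lemma ideal_graded n f a : a \in I_ n -> mdiag (f \o wd) a \in I_ n.
Proof.
move=> /idealP[F1 [F2 [h ->]]]; rewrite -shift0 !raddfD /=.
rewrite shift_Tx shift_Ty shift_z; apply/idealP.
by do 3!eexists.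
Qed.

Local Notation I := (I_ r.+2).

Lemma Im_sub_ideal a : a \in Im -> a \in I.
Proof.
move=> /ImP[F1 [F2 [h ->]]]; apply/idealP.
exists (z * dz F1 - F1 + z * dy h), (z * dz F2 - F2 - z * dx h),
  (- (dx F1 + dy F2)).
by rewrite /rel; ring.
Qed.

Lemma ideal_mod_Im a : a \in I -> exists u, a - T * u \in Im.
Proof.
move=> /idealP[F1 [F2 [h ->]]].
have := rpredD (gradT_mod_Im F1 F2) (zXnD_mod_Im (L h)); rewrite DL.
move: (L _) (z * _ - _) => u1 u2 aIm; exists (u1 *+ d + u2 *+ d).
by rewrite (_ : _ - _ = Tx * F1 + Ty * F2 - T * u1 *+ d
                      + (z ^+ r.+2 * h - T * u2 *+ d)) //; ring.
Qed.

(** In [Asing P] the powers of ['X_i] are linearly dependent. The Jacobian ideal of [P] is graded,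
    so it contains one of them, and truncation modulo [z ^+ r.+1] removes the third generator. *)
Lemma power_in_gradT i : i != iz -> isolated_singularity P ->
  exists N a b, 'X_i ^+ N = Tx * a + Ty * b.
Proof.
move=> iNz [n [b bP]].
have [a aP] := choice (fun j : 'I_n.+1 => bP (coker_pi _ ('X_i ^+ j))).
pose M : 'M[K]_(n.+1, n) := \matrix_(j, k) a j k.
have kM0 : kermx M != 0.
  by rewrite -mxrank_eq0 mxrank_ker subn_eq0 -ltnNge ltnS rank_leq_col.
pose v := nz_row (kermx M).
have v0 : v != 0 by rewrite nz_row_eq0.
have vM : v *m M = 0 by apply/sub_kermxP/nz_row_sub.
have [j0 vj0] : exists j0, v 0 j0 != 0.
  by move/rV0Pn: v0.
have pE : \sum_j v 0 j *: 'X_i ^+ j \in I_ r.+1.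
  suff /coker_piP[u] : coker_pi (dot_grad P) (\sum_j v 0 j *: 'X_i ^+ j) =
      coker_pi _ 0 by rewrite subr0 => ->; apply/limageP; exists u.
  rewrite raddf0 linear_sum /=.
  under eq_bigr do rewrite linearZ /= aP scaler_sumr.
  rewrite exchange_big big1 //= => k _; under eq_bigr do rewrite scalerA.
  rewrite -scaler_suml; have /rowP/(_ k) := vM; rewrite !mxE => vMk.
  rewrite [X in X *: _](_ : _ = 0) ?scale0r // -[RHS]vMk.
  by apply: eq_bigr => j _; rewrite mxE.
pose wi := wd U_(i)%MM.
have wi_gt0 : (0 < wi)%N.
  rewrite lt0n wdeg_eq0; apply/eqP => /mnmP/(_ i).
  by rewrite mnm1E eqxx mnm0E.
have wdXi j : wd (U_(i) *+ j)%MM = (j * wi)%N.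
  by rewrite /wi /wdeg !mulmnE; lia.
have := ideal_graded (fun e => (e == j0 * wi)%N%:R) pE.
rewrite raddf_sum (bigD1 j0) //= [X in _ + X]big1 ?addr0; last first.
  move=> j jj0; rewrite linearZ /= mdiag_eq0 ?scaler0 // => m.
  rewrite mpolyXn msuppX inE => /eqP->; rewrite /= wdXi eqn_pmul2r //.
  by rewrite (negPf jj0 : (j == j0 :> nat) = false).
rewrite linearZ /= mdiag_id; last first.
  by move=> m; rewrite mpolyXn msuppX inE => /eqP->; rewrite /= wdXi eqxx.
move=> /(rpredZ (v 0 j0)^-1); rewrite scalerK // => /idealP[F1 [F2 [h XE]]].
have := congr1 (mdiag (fun m => (m iz < r.+1)%:R)) XE.
rewrite !raddfD /= mdiag_XnM addr0.
rewrite mdiag_id; last first.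
  move=> m; rewrite mpolyXn msuppX inE => /eqP->.
  by rewrite mulmnE mnm1E (negPf iNz).
rewrite !(@mdiagM _ _ _ (fun m => (m iz < r.+1)%:R)) => [XE'||]; last 2 first.
- by move=> m /msupp_Ty[m0 _] m'; rewrite mnmDE m0.
- by move=> m /msupp_Tx[m0 _] m'; rewrite mnmDE m0.
by exists j0; do 2!eexists; exact: XE'.
Qed.

Hypothesis w3_le : (w3 <= w1 + w2)%N.
Local Notation c := (w1 + w2 - w3)%N.

(** This is [zXnD_mod_Im] at [L v], divided by [r.+2]; the operator [D + w3 (theta - 1)] multiplies
    a monomial by its weight plus [c]. *)
Lemma P_mod_Im v :
  P * v - T * mdiag (fun m => (wd m + c)%:R / (wxy m + (w1 + w2))%:R) v \in Im.
Proof.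
set u := L v; set W := z * dz u - u.
have -> : mdiag (fun m => (wd m + c)%:R / (wxy m + (w1 + w2))%:R) v =
    v + W *+ w3.
  apply/mpolyP => m; rewrite mcoeff_diag mcoeffD mcoeffMn mcoeffB XiM_mderiv.
  rewrite !mcoeff_diag.
  have : ((wxy m + (w1 + w2))%:R : K) != 0.
    by rewrite natr_neq0 // addn_gt0 orbC addn_gt0 w1_gt0.
  have -> : (wd m + c)%:R =
      (wxy m + (w1 + w2))%:R + (m iz * w3)%:R - w3%:R :> K.
    apply/eqP; rewrite eq_sym subr_eq -!natrD; apply/eqP; congr _%:R.
    by rewrite /wdeg; lia.
  by rewrite natrM; move: (_ + (w1 + w2))%N => n n0; field.
have -> : P * v - T * (v + W *+ w3) =
    (r.+2%:R : K)^-1 *: (z ^+ r.+2 * D u - T * W *+ d).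
  rewrite DL scalerBr (mulnC r.+2 w3) mulrnA -[_ *+ w3 *+ _]scaler_nat scalerA.
  by rewrite mulVf ?natr_neq0 // scale1r /P mulrDl -scalerAl; ring.
by rewrite rpredZ // zXnD_mod_Im.
Qed.

(** * Syzygies of the partial derivatives, and division by [P] *)

Hypothesis xN_in : exists N a b, x ^+ N = Tx * a + Ty * b.
Hypothesis yN_in : exists N a b, y ^+ N = Tx * a + Ty * b.

(** [Ty] divides [Tx * a], hence the products of [a] with powers of [x] and [y] lying in [(Tx, Ty)],
    and these powers are coprime. If [Ty = 0], the argument is applied to [Tx] and [b]. *)
Lemma koszul_xy a b :
  Tx * a + Ty * b = 0 -> exists q, a = q * Ty /\ b = - (q * Tx).
Proof.
move=> ab0; have [N1 [a1 [b1 e1]]] := xN_in; have [N2 [a2 [b2 e2]]] := yN_in.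
have abE : Tx * a = - (Ty * b) by apply/eqP; rewrite -addr_eq0 ab0.
have [Ty0|Ty0] := eqVneq Ty 0.
  have Tx0 : Tx != 0.
    have := mpolyXin_neq0 K ix N1; rewrite e1 Ty0 mul0r addr0.
    by apply: contraNneq => ->; rewrite mul0r.
  have [q ->] : exists q, b = Tx * q.
    apply: (@dvd_of_dvd_MXn _ _ ix iy isT _ _ _ _ N1 N2 Tx0
      (_ : _ = Tx * (b * a1)) (_ : _ = Tx * (b * a2))).
      by rewrite e1 Ty0; ring.
    by rewrite e2 Ty0; ring.
  exists (- q); split; last by ring.
  by apply: (mulfI Tx0); rewrite abE Ty0; ring.
have [q aE] : exists q, a = Ty * q.
  apply: (@dvd_of_dvd_MXn _ _ ix iy isT _ _ _ _ N1 N2 Ty0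
    (_ : _ = Ty * (a * b1 - b * a1)) (_ : _ = Ty * (a * b2 - b * a2))).
    rewrite e1 mulrDr mulrA [a * Tx]mulrC abE; ring.
  rewrite e2 mulrDr mulrA [a * Tx]mulrC abE; ring.
exists q; split; first by rewrite aE mulrC.
by apply: (mulfI Ty0); rewrite -[LHS]opprK -abE aE; ring.
Qed.

(** The remainders of [F1] and [F2] modulo [z ^+ n] form a syzygy of [Tx] and [Ty] alone, since
    their combination is both reduced and a multiple of [z ^+ n]. *)
Lemma koszul_xyz n F1 F2 h : Tx * F1 + Ty * F2 + z ^+ n * h = 0 ->
  exists V1 V2 q, [/\ F1 = z ^+ n * V1 + q * Ty, F2 = z ^+ n * V2 - q * Tx &
                      h = - (Tx * V1 + Ty * V2)].
Proof.
have [V1 F1E] := mpoly_divXn iz n F1; have [V2 F2E] := mpoly_divXn iz n F2.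
set R1 := mdiag _ F1 in F1E; set R2 := mdiag _ F2 in F2E; move=> F0.
have RE : Tx * R1 + Ty * R2 = z ^+ n * - (h + (Tx * V1 + Ty * V2)).
  by apply/eqP; rewrite -subr_eq0 -F0 F1E F2E; apply/eqP; ring.
have R0 : Tx * R1 + Ty * R2 = 0.
  rewrite -(mdiag_XnM iz n (- (h + (Tx * V1 + Ty * V2)))) -RE raddfD /=.
  rewrite !(@mdiagM _ _ _ (fun m => (m iz < n)%:R)) ?mdiag_ltnK //.
    by move=> m /msupp_Ty[m0 _] m'; rewrite mnmDE m0.
  by move=> m /msupp_Tx[m0 _] m'; rewrite mnmDE m0.
have [q [R1E R2E]] := koszul_xy R0.
exists V1, V2, q; split; first by rewrite F1E R1E addrC.
  by rewrite F2E R2E addrC.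
apply/eqP; rewrite -addr_eq0 -oppr_eq0; apply/eqP.
by apply: (mulfI (mpolyXin_neq0 K iz n)); rewrite -RE R0 mulr0.
Qed.

(** Multiplied by [d], the membership becomes a syzygy through Euler's formula. The term [T * e]
    serves the case [c = 0], where [B] is [T]. *)
Lemma PM_TM_in_Im g e : P * g + T * e \in Im ->
  mdiag (fun m => (wd m + c)%:R) g + D e \in Im.
Proof.
move=> /ImP[F1 [F2 [h E]]].
have PE : P *+ d = T *+ d + z ^+ r.+2 *+ w3.
  rewrite /P mulrnDl; congr (_ + _); rewrite mulrnA -[(_ *: _) *+ _]scaler_nat.
  by rewrite scalerA mulfV ?natr_neq0 // scale1r.
have [|V1 [V2 [q [V1E V2E divFE]]]] := @koszul_xyz r.+2
  (x * (g + e) *+ w1 - (z * dz F1 - F1 + z * dy h) *+ d)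
  (y * (g + e) *+ w2 - (z * dz F2 - F2 - z * dx h) *+ d)
  (g *+ w3 + (dx F1 + dy F2) *+ d).
  transitivity ((x * Tx *+ w1 + y * Ty *+ w2) * (g + e) + z ^+ r.+2 * g *+ w3
                - rel F1 F2 h *+ d).
    by rewrite /rel; ring.
  by rewrite euler_T -E mulrnDl -![in X in _ - X]mulrnAl PE; ring.
have dxE := congr1 dx V1E; have dyE := congr1 dy V2E.
set N := (r.+2 * w3)%N in divFE dxE dyE.
suff -> : mdiag (fun m => (wd m + c)%:R) g + D e =
    - (rel V1 V2 0 + (Tx * dy q - Ty * dx q)).
  by rewrite rpredN rpredD ?J_in_Im //; apply/ImP; exists V1, V2, 0.
have natc (u : A) : u *+ c = u *+ (w1 + w2) - u *+ w3.
  by rewrite -mulrnBr.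
have dzE := congr1 dz divFE.
move: dxE dyE dzE; rewrite mdiag_wd mdiag_wxy natc /rel.
rewrite !(mderivB, mderivD, mderivMn, mderivM, mderivXU, mderiv_zXn).
rewrite !(mderivN, mderivD, mderivM, mderiv0, dzTx, dzTy) /=.
rewrite [dx (dz _)]mderiv_comm [dy (dz _)]mderiv_comm.
rewrite [dx (dy h)]mderiv_comm [dy (dx T)]mderiv_comm.
move=> e1 e2 e3; set G := (_ + _ : A).
(* The divergence of the first two components plus [theta - 1] of the third eliminates [F1], [F2]
   and [h]. *)
have := congr2 (fun a b => a - b)
  (congr2 +%R (congr2 +%R e1 e2) (congr1 ( *%R z) e3)) divFE.
by apply: eq_of_subr; rewrite /G; ring.
Qed.

(** * The hypotheses of the decomposition, for [Im] and [I] *)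

Lemma idealM a u : a \in I -> a * u \in I.
Proof.
move=> /idealP[F1 [F2 [h ->]]]; apply/idealP.
by exists (F1 * u), (F2 * u), (h * u); ring.
Qed.

Lemma TM_ideal u : T * u \in I.
Proof.
have TE : T *+ d \in I.
  apply/idealP; exists (x *+ w1), (y *+ w2), 0.
  by rewrite -euler_T; ring.
rewrite (_ : T * u = (d%:R : K)^-1 *: (T *+ d * u)).
  by rewrite rpredZ ?idealM.
by rewrite mulrnAl -scaler_nat scalerA mulVf ?scale1r // natr_neq0 //; lia.
Qed.

Lemma PM_ideal u : P * u \in I.
Proof.
rewrite /P mulrDl rpredD ?TM_ideal // -scalerAl rpredZ //.
by apply/idealP; exists 0, 0, u; ring.
Qed.

Lemma ideal_full : 1 \in I -> forall a, a \in I.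
Proof. by move=> I1 a; rewrite -[a]mul1r; apply: idealM. Qed.

Lemma ideal_proper : 1 \notin I -> forall a, a \in I -> a@_0%MM = 0.
Proof.
move=> I1 a /(ideal_graded (fun n => (n == 0%N)%:R)) aI.
apply/eqP; apply: contraNT I1 => a0.
rewrite -[1](scalerK a0) rpredZ //.
rewrite (_ : _ *: 1 = mdiag ((fun n => (n == 0%N)%:R) \o wd) a) //.
apply/mpolyP => m; rewrite mcoeff_diag mcoeffZ mcoeff1 /= wdeg_eq0 mulrC.
by case: eqP => [->|]; rewrite ?mul0r.
Qed.

Lemma zXn0 n : (z ^+ n.+1)@_0%MM = 0.
Proof.
rewrite mpolyXn mcoeffX; case: eqP => // /mnmP/(_ iz).
by rewrite mulmnE mnm1E mnm0E.
Qed.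

(** Here [w3 = w1 + w2], so [d] exceeds [w1] and [w2], and all three generators vanish at the
    origin. *)
Lemma ideal_properS : c = 0%N -> 1 \notin I.
Proof.
move=> c0; apply/negP => /idealP[F1 [F2 [h /(congr1 (mcoeff 0%MM))]]].
have MC p q : (p * q)@_0%MM = p@_0%MM * q@_0%MM by exact: rmorphM.
rewrite mcoeff1 eqxx !mcoeffD (MC Tx) (MC Ty) (MC (z ^+ _)) zXn0.
have -> : Tx@_0%MM = 0.
  apply: memN_msupp_eq0; apply/negP => /msupp_Tx[_].
  by rewrite /wdeg !mnm0E; nia.
have -> : Ty@_0%MM = 0.
  apply: memN_msupp_eq0; apply/negP => /msupp_Ty[_].
  by rewrite /wdeg !mnm0E; nia.
by move=> /eqP; rewrite !mul0r !addr0 oner_eq0.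
Qed.

Let B : A := if c == 0%N then T else P.

Lemma BM_ideal u : B * u \in I.
Proof. by rewrite /B; case: eqP => _; rewrite ?TM_ideal ?PM_ideal. Qed.

Lemma T0 : T@_0%MM = 0.
Proof.
apply: memN_msupp_eq0; apply/negP => /T_whomog.
by rewrite /wdeg !mnm0E; nia.
Qed.

Lemma P0 : P@_0%MM = 0.
Proof.
by rewrite mcoeffD mcoeffZ T0 add0r zXn0 mulr0.
Qed.

Lemma B0 : B@_0%MM = 0.
Proof. by rewrite /B; case: eqP; rewrite ?T0 ?P0. Qed.

Lemma msupp_TXn n m : m \in msupp (T ^+ n) -> m iz = 0%N /\ wd m = (n * d)%N.
Proof.
elim: n m => [|n IH] m.
  by rewrite expr0 msupp1 inE => /eqP->; rewrite /wdeg !mnm0E.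
rewrite exprS => /msuppM_le/allpairsP[[m1 m2] /= [m1T /IH[z2 w2E] ->]].
by rewrite wdegD w2E (T_whomog m1T) mnmDE z2 (T_zfree m1T) mulSn.
Qed.

(** For [c = 0] this is the factor of [P_mod_Im] on [T ^+ i.+1], which is free of [z] and of weight
    [i.+1 * d]. *)
Definition gam i : K :=
  if c == 0%N then (i.+1 * d)%:R / (i.+1 * d + (w1 + w2))%:R else 1.

Lemma gam_neq0 i : gam i != 0.
Proof.
rewrite /gam; case: (c == 0%N); last exact: oner_neq0.
by rewrite mulf_neq0 ?invr_eq0 // natr_neq0 //; lia.
Qed.

Lemma PBX_in_Im i : P * B ^+ i.+1 - gam i *: B ^+ i.+2 \in Im.
Proof.
rewrite /B /gam; case: eqP => [c0|_].
  rewrite (_ : _ *: T ^+ i.+2 = T * mdiag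
    (fun m => (wd m + c)%:R / (wxy m + (w1 + w2))%:R) (T ^+ i.+1)).
    exact: P_mod_Im.
  rewrite [T ^+ i.+2]exprS scalerAr; congr (_ * _).
  apply/mpolyP => m; rewrite mcoeff_diag mcoeffZ.
  have [/msupp_TXn[mz wdm]|/memN_msupp_eq0->] :=
    boolP (m \in msupp (T ^+ i.+1)); last by rewrite !mulr0.
  by rewrite c0 addn0 wdm -wdm /wdeg mz mul0n addn0.
by rewrite scale1r -exprS subrr rpred0.
Qed.

(** For [c = 0], [PM_TM_in_Im] leaves the constant term [(w1 + w2) s], so [s = 0], and the weight is
    invertible on the monomials of [g]. For [c > 0], [B = P] and the operator is invertible on
    [g + s%:MP]. *)
Lemma Im_regular : 1 \notin I -> forall g (s : K),
  g@_0%MM = 0 -> P * g + s *: B \in Im -> s = 0 /\ g \in Im.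
Proof.
move=> I1 g s g0.
rewrite /B; case: eqP => [c0|/eqP c0].
  rewrite -mul_mpolyC [_ * T]mulrC => /PM_TM_in_Im gIm.
  have s0 : s = 0.
    have := ideal_proper I1 (Im_sub_ideal gIm).
    rewrite mcoeffD !mcoeff_diag g0 mulr0 add0r mcoeffC eqxx mulr1 !mnm0E.
    move=> /eqP; rewrite mulf_eq0 (negPf (natr_neq0 _)) ?orFb => [/eqP//|].
    by lia.
  split=> //; have := Im_graded (fun n => n%:R^-1) gIm.
  rewrite s0 raddf0 addr0 mdiag_comp mdiag_id // => m mg.
  rewrite c0 addn0 /= mulVf // natr_neq0 // lt0n wdeg_eq0.
  by apply: contraTneq mg => ->; rewrite mcoeff_msupp g0 eqxx.
rewrite -mul_mpolyC [_ * P]mulrC -mulrDr => PgIm.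
have gIm : g + s%:MP \in Im.
  have := @PM_TM_in_Im (g + s%:MP) 0; rewrite mulr0 raddf0 !addr0 => /(_ PgIm).
  move=> /(Im_graded (fun n => (n + c)%:R^-1)); rewrite mdiag_comp mdiag_id //.
  by move=> m _; rewrite /= mulVf // natr_neq0 //; lia.
have s0 : s = 0.
  have := ideal_proper I1 (Im_sub_ideal gIm).
  by rewrite mcoeffD g0 mcoeffC eqxx mulr1 add0r.
by split=> //; move: gIm; rewrite s0 addr0.
Qed.

Lemma ideal_mod_Im_filtered N a :
  a \in I -> {in msupp a, forall m, (wd m < N.+1)%N} ->
  exists g (s : K), [/\ a - (P * g + s *: B) \in Im,
    {in msupp g, forall m, (wd m < N)%N},
    1 \in I -> s = 0 & 1 \notin I -> g@_0%MM = 0].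
Proof.
move=> aI aN; have [u0 u0Im] := ideal_mod_Im aI.
pose f n : K := (n < N.+1)%:R.
(* Only the part of [u0] that [T] carries to weight at most [N] is kept; as [d > 0], its weight is
   below [N]. *)
pose u := mdiag (shift f d 0) u0.
have uIm : a - T * u \in Im.
  have := Im_graded f u0Im; rewrite raddfB /= -[in mdiag _ (T * _)]shift0.
  by rewrite shift_T mdiag_id // => m /aN; rewrite /f /= => ->.
(* This inverts the operator of [P_mod_Im]. For [c = 0] the constant term is lost, as [0^-1 = 0],
   and returns as the multiple of [B = T]. *)
pose g := mdiag (fun m => (wxy m + (w1 + w2))%:R / (wd m + c)%:R) u.
have gN : {in msupp g, forall m, (wd m < N)%N}.
  move=> m; rewrite mcoeff_msupp !mcoeff_diag /shift /f.
  case: ltnP => [mN _|_]; first by lia.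
  by rewrite mul0r mulr0 eqxx.
have D0 m : ((wxy m + (w1 + w2))%:R : K) != 0.
  by rewrite natr_neq0 //; lia.
have wd0 : wd 0%MM = 0%N by apply/eqP; rewrite wdeg_eq0.
have [c0|c0] := eqVneq c 0%N.
  exists g, (u@_0%MM); rewrite /B c0 eqxx; split=> //.
  - have := rpredB uIm (P_mod_Im g); rewrite mdiag_comp.
    set v := mdiag _ _.
    have -> : v = u - (u@_0%MM)%:MP.
      apply/mpolyP => m; rewrite mcoeff_diag mcoeffB mcoeffC c0 addn0.
      have [->|m0] := eqVneq m 0%MM.
        by rewrite wd0 ?mul0r ?mulr1 ?subrr.
      have wdm : ((wd m)%:R : K) != 0 by rewrite natr_neq0 // lt0n wdeg_eq0.
      by rewrite mulr0 subr0 mulrA divfK ?D0 // mulfV // mul1r.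
    rewrite -mul_mpolyC.
    by rewrite (_ : _ - _ - _ = a - (P * g + (u@_0)%:MP * T)) //; ring.
  - by rewrite (negPf (ideal_properS c0)).
  - by move=> _; rewrite mcoeff_diag c0 addn0 wd0 ?invr0 ?mulr0 ?mul0r.
have gIm : a - P * g \in Im.
  have := rpredB uIm (P_mod_Im g); rewrite mdiag_comp mdiag_id.
    by rewrite (_ : _ - _ - _ = a - P * g) //; ring.
  by move=> m _; rewrite mulrA divfK ?D0 // mulfV // natr_neq0 //; lia.
have [I1|I1] := boolP (1 \in I).
  by exists g, 0; split=> //; rewrite scale0r addr0.
exists (g - (g@_0%MM)%:MP), (g@_0%MM); split=> //.
- rewrite /B (negPf c0) -mul_mpolyC.
  by rewrite (_ : _ + _ = P * g) //; ring.
- move=> m; rewrite mcoeff_msupp mcoeffB mcoeffC.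
  have [->|m0] := eqVneq m 0%MM; first by rewrite mulr1 subrr eqxx.
  by rewrite mulr0 subr0 -mcoeff_msupp; apply: gN.
- by rewrite mcoeffB mcoeffC eqxx mulr1 subrr.
Qed.

(** * The bilinear map of the tensor product *)

Local Notation P' := (T + (r.+3%:R : K)^-1 *: z ^+ r.+3).

Definition asing_nf (c : Asing P') : A := nform I (coker_repr c).

Lemma asing_nf_is_linear : linear asing_nf.
Proof.
move=> s c1 c2; rewrite /asing_nf -linearP; apply: nform_eq.
by apply/limageP/coker_piP; rewrite linearP /= !coker_reprK.
Qed.

HB.instance Definition _ :=
  GRing.isLinear.Build K (Asing P') A *:%R asing_nf asing_nf_is_linear.

Lemma asing_nfK : cancel asing_nf (coker_pi (dot_grad P')).
Proof.
move=> c; rewrite -[RHS]coker_reprK; apply/esym/coker_piP/limageP.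
exact: subr_nform.
Qed.

Lemma asing_nf_pi a : asing_nf (coker_pi (dot_grad P') a) = nform I a.
Proof. by apply: nform_eq; apply/limageP/coker_piP; rewrite coker_reprK. Qed.

(* Maps [P ^+ i] to [B ^+ i]: for [c = 0] it is the evaluation at [z = 0]. *)
Local Notation unit_factor := (mdiag (fun m => ((c != 0) || (m iz < 1))%N%:R)).

(** The linear operator [unit_factor] treats the constants, so that bilinearity needs no expansion
    of [Q] in powers of [P]. *)
Definition ph3_tensor (Q : Kadjoin P) (c : Asing P') : PH3 z P :=
  coker_pi (delta2 z P)
    (Kadjoin_val Q * (asing_nf c - ((asing_nf c)@_0%MM)%:MP)
     + (asing_nf c)@_0%MM *: unit_factor (Kadjoin_val Q)).

Lemma ph3_tensor_is_bilinear : bilinear_for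
  (GRing.Scale.Law.clone _ _ *:%R _) (GRing.Scale.Law.clone _ _ *:%R _)
  ph3_tensor.
Proof.
split=> [cc|Q] s u v /=; rewrite /ph3_tensor -linearP; congr coker_pi.
  rewrite linearP /= -!mul_mpolyC; ring.
rewrite !linearP /= -!mul_mpolyC mpolyCD mpolyCM; ring.
Qed.

HB.instance Definition _ := bilinear_isBilinear.Build K
  (Kadjoin P) (Asing P') (PH3 z P) _ _ ph3_tensor ph3_tensor_is_bilinear.

Lemma unit_factor_PXn i : unit_factor (P ^+ i) = B ^+ i.
Proof.
rewrite /B; case: (c == 0%N) => /=; last by rewrite mdiag_id.
have [q ->] : exists q, P ^+ i = T ^+ i + z ^+ 1 * q.
  elim: i => [|i [q IH]]; first by exists 0; ring.
  exists (T * q + (r.+2%:R : K)^-1 *: z ^+ r.+1 * P ^+ i).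
  rewrite exprS {1}/P mulrDl {1}IH [T ^+ i.+1]exprS [z ^+ r.+2]exprS.
  by rewrite scalerAr; ring.
rewrite raddfD /= mdiag_XnM addr0 mdiag_id // => m /msupp_TXn[-> _].
by [].
Qed.

Definition Kgen : Kadjoin P :=
  KAdjoin (introT (genalgP P P) (ex_intro _ 'X (esym (horner_algX P)))).

Lemma Kadjoin_valX i : Kadjoin_val (Kgen ^+ i) = P ^+ i.
Proof. exact: (rmorphXn (val : Kadjoin P -> A) i Kgen). Qed.

Lemma Kadjoin_span (Q : Kadjoin P) :
  exists n (s : nat -> K), Q = \sum_(i < n) s i *: Kgen ^+ i.
Proof.
have /genalgP[q QE] := valP Q.
exists (size q), (fun i => q`_i); apply: val_inj; rewrite raddf_sum [LHS]QE.
rewrite -[q in LHS]coefK poly_def rmorph_sum /=; apply: eq_bigr => i _.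
rewrite [LHS]linearZ [RHS]linearZ /= Kadjoin_valX rmorphXn /= horner_algX.
by rewrite mulr_algl; congr (_ *: _); apply: val_inj.
Qed.

(** On powers of [P] the map produces the classes of the [term]s, to which [term_span] and
    [term_free] apply. *)
Lemma ph3_tensorX i a s : reduced I a -> a@_0%MM = 0 -> (1 \in I -> s = 0) ->
  ph3_tensor (Kgen ^+ i) (coker_pi (dot_grad P') (a + s%:MP)) =
  coker_pi (delta2 z P) (P ^+ i * a + s *: B ^+ i).
Proof.
move=> ra a0 s0; rewrite /ph3_tensor asing_nf_pi nform_id; last first.
  rewrite -[a]scale1r; apply: reducedP => //.
  exact: (reduced_C ideal_proper).
rewrite mcoeffD a0 mcoeffC eqxx mulr1 add0r addrK.
by rewrite Kadjoin_valX unit_factor_PXn.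
Qed.

Lemma ideal_filtered N a :
  a \in I -> mdiag (fun m => (wd m < N)%:R) a \in I.
Proof. exact: (ideal_graded (fun n => (n < N)%:R)). Qed.

Lemma ph3_tensor_product : is_tensor_product ph3_tensor.
Proof.
apply: (@tensor_product_criterion _ _ _ _ _ (fun i => Kgen ^+ i)).
- exact: Kadjoin_span.
- move=> w; have [n [u [e [ad wE]]]] := term_span ideal_proper ideal_full
    ideal_filtered PM_in_Im PBX_in_Im ideal_mod_Im_filtered (coker_repr w).
  exists n, (fun i => coker_pi (dot_grad P') (u i + (e i)%:MP)).
  transitivity (coker_pi (delta2 z P) (\sum_(i < n) term P B u e i)).
    rewrite -[LHS]coker_reprK; apply/coker_piP/limageP.
    exact: wE.
  rewrite raddf_sum; apply: eq_bigr => i _; have [ru u0 e0] := ad i.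
  exact/esym/(ph3_tensorX i ru u0 e0).
move=> n s sE i iN.
pose e j := (asing_nf (s j))@_0%MM.
pose u j := asing_nf (s j) - (e j)%:MP.
have ad : admissible I u e.
  move=> j; have [] := reduced_split ideal_proper ideal_full
    (@nform_reduced _ _ I (coker_repr (s j))).
  by split.
have sumIm : \sum_(j < n) term P B u e j \in Im.
  apply/limageP; suff /coker_piP[v] : coker_pi (delta2 z P)
    (\sum_(j < n) term P B u e j) = coker_pi _ 0 by rewrite subr0; exists v.
  rewrite raddf0 -[RHS]sE raddf_sum; apply: eq_bigr => j _.
  have [ru u0 e0] := ad j; apply: etrans (esym (ph3_tensorX j ru u0 e0)) _.
  by rewrite subrK asing_nfK.
have [ui ei] := term_free Im_sub_ideal ideal_proper ideal_full PM_ideal BM_ideal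
  B0 gam_neq0 PBX_in_Im Im_regular ad sumIm iN.
rewrite -[s i]asing_nfK -[asing_nf _](subrK (e i)%:MP) -/(u i) ui ei.
by rewrite addr0 raddf0.
Qed.

Lemma ph3_tensor_whomog n k (Q : Kadjoin P) (b : Asing P') :
  whomog_deg w1 w2 w3 n (Kadjoin_val Q) -> coker_whomog_deg w1 w2 w3 k b ->
  coker_whomog_deg w1 w2 w3 (n + k) (ph3_tensor Q b).
Proof.
move=> Qn [a ak <-]; eexists; last by [].
rewrite asing_nf_pi; set a' := nform I a.
have a'k : whomog_deg w1 w2 w3 k a'.
  have aE : a = mdiag ((fun e => (e == k)%:R) \o wd) a.
    by rewrite mdiag_id // => m /ak /= ->; rewrite eqxx.
  move=> m; rewrite /a' aE mdiag_nform; last exact: ideal_graded.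
  rewrite mcoeff_msupp mcoeff_diag /=.
  by case: (wd m =P k) => //; rewrite mul0r eqxx.
move=> m /msuppD_le; rewrite mem_cat => /orP[|].
  move=> /msuppM_le/allpairsP[[m1 m2] /= [m1Q m2a ->]].
  rewrite wdegD (Qn _ m1Q) a'k //.
  move: m2a; rewrite !mcoeff_msupp mcoeffB mcoeffC.
  have [->|_] := eqVneq m2 0%MM; first by rewrite mulr1 subrr eqxx.
  by rewrite mulr0 subr0.
have [->|a0] := eqVneq a'@_0%MM 0; first by rewrite scale0r msupp0.
(* A nonzero constant term forces degree 0, and [unit_factor] only deletes monomials of [Q]. *)
have k0 : k = 0%N.
  by rewrite -(a'k 0%MM) ?mcoeff_msupp //; apply/eqP; rewrite wdeg_eq0.
rewrite k0 addn0 => /msuppZ_le; rewrite mcoeff_msupp mcoeff_diag.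
rewrite mulf_eq0 negb_or => /andP[_]; rewrite -mcoeff_msupp; exact: Qn.
Qed.

(** The representative is the normal form; [unit_factor] fixes [1], and is the identity for
    [c > 0]. *)
Lemma ph3_tensor_normalized (b : Asing P') : exists a,
  [/\ coker_pi (dot_grad P') a = b,
      ph3_tensor 1 b = coker_pi (delta2 z P) a &
      (0 < c)%N \/ a@_0%MM = 0 -> forall Q : Kadjoin P,
      ph3_tensor Q b = coker_pi (delta2 z P) (Kadjoin_val Q * a)].
Proof.
exists (asing_nf b); split; first exact: asing_nfK.
  rewrite /ph3_tensor mul1r mdiag_id ?alg_mpolyC ?subrK //.
  by move=> m; rewrite msupp1 inE => /eqP->; rewrite mnm0E orbT.
move=> h Q; congr coker_pi; case: h => [c_gt0|->].
  rewrite (_ : (c != 0)%N = true) -?lt0n // mdiag_id // -mul_mpolyC; ring.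
by rewrite scale0r addr0 mpolyC0 subr0.
Qed.

End Poisson.

(** * Transfer of the hypotheses on [P] to its part in [x] and [y] *)

Lemma msupp_mwiden (n : nat) (R : nzRingType) (p : {mpoly R[n]}) m :
  m \in msupp (mwiden p) -> m ord_max = 0%N.
Proof.
move=> mp; apply: contraTeq mp => m0.
rewrite -mcoeff_eq0 (mwidenE (leqnn _)) raddf_sum big1 //= => i _.
rewrite mcoeffZ mcoeffX; case: eqP => [mE|_]; last by rewrite mulr0.
by rewrite -mE mnmwiden_ordmax in m0.
Qed.

Theorem theorem6p2 (K : fieldType) (charK : [pchar K] =i pred0)
  (r : nat) (Pt : {mpoly K[2]}) (P P' : {mpoly K[3]})
  (defP : P = mwiden Pt + (r.+2%:R : K)^-1 *: 'X_iz ^+ r.+2)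
  (defP' : P' = mwiden Pt + (r.+3%:R : K)^-1 *: 'X_iz ^+ r.+3)
  (w1 w2 w3 : nat)
  (w_gt0 : [/\ (0 < w1)%N, (0 < w2)%N & (0 < w3)%N])
  (w_coprime : gcdn (gcdn w1 w2) w3 = 1%N)
  (P_whomog : whomog w1 w2 w3 P)
  (P_isolated : isolated_singularity P)
  (w_ge0 : 0 <= w1%:Z + w2%:Z - w3%:Z) :
  exists t : {bilinear (Kadjoin P) -> (Asing P') -> (PH3 'X_iz P)},
    [/\ is_tensor_product t,
        forall (d e : nat) (Q : Kadjoin P) (c : Asing P'),
          whomog_deg w1 w2 w3 d (Kadjoin_val Q) ->
          coker_whomog_deg w1 w2 w3 e c ->
          coker_whomog_deg w1 w2 w3 (d + e) (t Q c) &
        forall c : Asing P', exists a : {mpoly K[3]},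
          [/\ coker_pi (dot_grad P') a = c,
              t 1 c = coker_pi (delta2 'X_iz P) a &
              (0 < w1%:Z + w2%:Z - w3%:Z) \/ a@_0%MM = 0 ->
              forall Q : Kadjoin P,
                t Q c = coker_pi (delta2 'X_iz P) (Kadjoin_val Q * a)]].
Proof.
subst P P'; have [w1_gt0 w2_gt0 w3_gt0] := w_gt0.
have w3_le : (w3 <= w1 + w2)%N by lia.
set T := mwiden Pt.
have T_zfree : {in msupp T, forall m : 'X_{1..3}, m iz = 0%N}.
  by move=> m /msupp_mwiden; rewrite (_ : ord_max = iz) //; exact: val_inj.
have zXnE (m : 'X_{1..3}) : m iz = 0%N -> ('X_iz ^+ r.+2 : {mpoly K[3]})@_m = 0.
  move=> m0; rewrite mpolyXn mcoeffX; case: eqP => // /mnmP/(_ iz).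
  by rewrite m0 mulmnE mnm1E.
have T_whomog : whomog_deg w1 w2 w3 (r.+2 * w3) T.
  have [_ [d dP]] := P_whomog.
  (* The monomial [z ^+ r.+2] does not cancel in [P] and fixes the degree. *)
  suff <- : d = (r.+2 * w3)%N.
    move=> m mT; apply: dP; rewrite mcoeff_msupp mcoeffD mcoeffZ.
    by rewrite zXnE ?T_zfree // mulr0 addr0 -mcoeff_msupp.
  rewrite -(dP (U_(iz) *+ r.+2)%MM).
    by rewrite /wdeg !mulmnE !mnm1E /=; lia.
  rewrite mcoeff_msupp mcoeffD mcoeffZ mpolyXn mcoeffX eqxx mulr1.
  rewrite memN_msupp_eq0 ?add0r ?invr_eq0 ?((pcharf0P K).1 charK) //.
  by apply/negP => /T_zfree; rewrite mulmnE mnm1E.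
have pow i : i != iz ->
    exists N a b, 'X_i ^+ N = mderiv ix T * a + mderiv iy T * b.
  move=> iz0.
  exact: (power_in_gradT charK _ _ _ T_zfree T_whomog iz0 P_isolated).
have xN := pow ix isT; have yN := pow iy isT.
exists (@ph3_tensor K r T w1 w2 w3); split.
- exact: (ph3_tensor_product charK _ _ _ T_zfree T_whomog w3_le xN yN).
- exact: (ph3_tensor_whomog charK w1_gt0 w2_gt0 w3_gt0 T_zfree T_whomog).
move=> c; have [a [aE t1 tQ]] := @ph3_tensor_normalized K r T w1 w2 w3 c.
exists a; split=> // h; apply: tQ; case: h => [h|->]; last by right.
by left; lia.
Qed.
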